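(* Let $X=(X_1,X_2)^\top\sim\mathcal N_2(\boldsymbol\mu,\boldsymbol\Sigma)$ be a bivariate normal random vector with mean $\boldsymbol\mu=(\mu_1,\mu_2)^\top\in\mathbb R^2$ and covariance matrix $\boldsymbol\Sigma$ having diagonal elements $\sigma_1^2,\sigma_2^2$ and off-diagonal element $\rho\sigma_1\sigma_2$, where $\sigma_1,\sigma_2>0$ and $|\rho|<1$, and let $R=\sqrt{X_1^2+X_2^2}$. With the constants and functions defined in the context, the moment generating function $M_R(t)=\mathbb E\{\exp(tR)\}$ exists (is finite) for all $t\in\mathbb R$ and equals $$M_R(t)=\alpha\sum_{j=0}^\infty\epsilon_j\cos(2j\delta)\left(\frac{\eta\psi^2}{8}\right)^j\sum_{k_1=0}^\infty\sum_{k_2=0}^\infty C(k_1,k_2,j;\psi,\eta)\,\mathcal I^{(\beta)}_{2\ell_{k_1,k_2}^{(j)}+1}(t),$$ where, for any positive odd integer $m$, $$\mathcal I^{(\beta)}_m(t)=\frac{\Gamma\left(\frac{m+1}{2}\right)}{2\beta^{\frac{m+1}{2}}}\;{}_1F_1\!\left(\frac{m+1}{2},\frac12,\frac{t^2}{4\beta}\right)+t\,\frac{\Gamma\left(\frac m2+1\right)}{2\beta^{\frac m2+1}}\;{}_1F_1\!\left(\frac m2+1,\frac32,\frac{t^2}{4\beta}\right),$$ which admits the alternative representation $$\mathcal I^{(\beta)}_m(t)=\frac{\sqrt\pi\exp\left(\frac{t^2}{4\beta}\right)}{2\beta^{\frac{m+1}{2}}}\left\{\Gamma\left(\frac m2+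1\right)L^{(-1/2)}_{m/2}\left(-\frac{t^2}{4\beta}\right)+\frac{t}{2\sqrt\beta}\,\Gamma\left(\frac{m+1}{2}\right)L^{(1/2)}_{(m-1)/2}\left(-\frac{t^2}{4\beta}\right)\right\}.$$
   Context: ${}_1F_1(a,b,z)=\sum_{n\ge0}\frac{a(a+1)\cdots(a+n-1)}{b(b+1)\cdots(b+n-1)}\frac{z^n}{n!}$ is Kummer's confluent hypergeometric function of the first kind. $L^{(a)}_\nu(x)$ is the Laguerre function of unrestricted order $\nu$, $L_\nu^{(a)}(x)=\frac{\Gamma(\nu+a+1)}{\Gamma(\nu+1)\Gamma(a+1)}\,{}_1F_1(-\nu,a+1,x)$; for nonnegative integer $\nu$ it is the associated Laguerre polynomial. $\epsilon_0=1$ and $\epsilon_j=2$ for $j\ge1$. The constants are $$\alpha=\frac{1}{\sigma_1\sigma_2\sqrt{1-\rho^2}}\exp\left(-\frac{\mu_1^2\sigma_2^2+\sigma_1^2\mu_2^2-2\rho\sigma_1\sigma_2\mu_1\mu_2}{2\sigma_1^2\sigma_2^2(1-\rho^2)}\right),\qquad \beta=\frac{\sigma_1^2+\sigma_2^2}{4\sigma_1^2\sigma_2^2(1-\rho^2)},$$ $$\eta=\frac{\sqrt{(\sigma_2^2-\sigma_1^2)^2+4\sigma_1^2\sigma_2^2\rho^2}}{4\sigma_1^2\sigma_2^2(1-\rho^2)},\qquad \psi=\frac{\sqrt{\sigma_1^2(\rho\mu_1\sigma_2-\mu_2\sigma_1)^2+\sigma_2^2(\rho\mu_2\sigma_1-\mu_1\sigma_2)^2}}{\sigma_1^2\sigma_2^2(1-\rho^2)},$$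 and $\delta=\tilde\phi-\phi/2$, where the angles $\tilde\phi,\phi$ satisfy $$\cos\tilde\phi=\frac{\mu_2\sigma_1^2-\rho\mu_1\sigma_1\sigma_2}{D},\quad \sin\tilde\phi=\frac{\mu_1\sigma_2^2-\rho\mu_2\sigma_1\sigma_2}{D},\quad D=\sqrt{\mu_1^2\sigma_2^4+\mu_2^2\sigma_1^4+\rho^2\sigma_1^2\sigma_2^2(\mu_1^2+\mu_2^2)-2\rho\mu_1\mu_2\sigma_1\sigma_2(\sigma_1^2+\sigma_2^2)},$$ $$\cos\phi=\frac{\sigma_2^2-\sigma_1^2}{\sqrt{(\sigma_1^2-\sigma_2^2)^2+4\rho^2\sigma_1^2\sigma_2^2}},\quad \sin\phi=\frac{2\rho\sigma_1\sigma_2}{\sqrt{(\sigma_1^2-\sigma_2^2)^2+4\rho^2\sigma_1^2\sigma_2^2}}.$$ If the denominator in the definition of $\tilde\phi$ (i.e. $\psi=0$) or of $\phi$ (i.e. $\eta=0$) vanishes, the corresponding angle is arbitrary. For nonnegative integers $k_1,k_2,j$ put $\ell_{k_1,k_2}^{(j)}=k_1+2k_2+2j$ and $$C(k_1,k_2,j;\psi,\eta)=\frac{\psi^{2k_1}\eta^{2k_2}}{4^{k_1+k_2}k_1!\,(k_1+2j)!\,k_2!\,(k_2+j)!}.$$ Convention: $0^0=1$. *)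

(* Defs.v *)
From HB Require Import structures.
From mathcomp Require Import all_boot all_order all_algebra.
From mathcomp Require Import all_classical all_reals all_analysis.

Set Implicit Arguments.
Unset Strict Implicit.
Unset Printing Implicit Defensive.

Import Order.TTheory GRing.Theory Num.Theory.
Import numFieldTopology.Exports numFieldNormedType.Exports.

Local Open Scope classical_set_scope.
Local Open Scope ring_scope.

(** ** Special functions *)

(* Sum of a real series. The value is meaningful only when the partial sums
   converge, i.e. under [cvgn (series u)]. *)
Definition rsum (R : realType) (u : nat -> R) : R := limn (series u).

Definition rising (R : realType) (a : R) (n : nat) : R :=
  \prod_(i < n) (a + i%:R).

Definition hyp1F1 (R : realType) (a b z : R) : R :=
  rsum (fun n => rising a n / rising b n * (z ^+ n / n`!%:R)).

Definition Gamma_pos (R : realType) (x : R) : R :=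
  \int[lebesgue_measure]_(u in `]0, +oo[) (u `^ (x - 1) * expR (- u)).

(* Euler's integral for [0 < x]; for [x <= 0] the usual continuation
   Gamma x = Gamma (x + n) / (x (x + 1) ... (x + n - 1)) with [0 < x + n].
   At the poles 0, -1, -2, ... the value is 0, because [0^-1 = 0]. *)
Definition Gamma (R : realType) (x : R) : R :=
  if 0 < x then Gamma_pos x
  else let n := (absz (Num.floor x)).+1 in Gamma_pos (x + n%:R) / rising x n.

Definition Laguerre (R : realType) (a nu x : R) : R :=
  Gamma (nu + a + 1) / (Gamma (nu + 1) * Gamma (a + 1))
  * hyp1F1 (- nu) (a + 1) x.

(** ** Bivariate normal vectors *)

Definition col2 (R : realType) (a b : R) : 'cV[R]_2 :=
  \col_i (if i == 0 then a else b).

Definition cov2 (R : realType) (sigma1 sigma2 rho : R) : 'M[R]_2 :=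
  \matrix_(i, j) (if i == j then (if i == 0 then sigma1 ^+ 2 else sigma2 ^+ 2)
                  else rho * sigma1 * sigma2).

(* Density of N_2(mu, Sigma), for a positive definite Sigma. *)
Definition normal2_pdf (R : realType) (mu : 'cV[R]_2) (Sigma : 'M[R]_2)
    (x : R * R) : R :=
  let v := col2 x.1 x.2 - mu in
  (2 * pi * Num.sqrt (\det Sigma))^-1
  * expR (- ((v^T *m invmx Sigma *m v) 0 0 / 2)).

Definition normal2 (d : measure_display) (T : measurableType d) (R : realType)
    (P : probability T R) (X : {RV P >-> (R * R)%type})
    (mu : 'cV[R]_2) (Sigma : 'M[R]_2) : Prop :=
  forall A : set (R * R), measurable A ->
    distribution P X A =
    (\int[(@lebesgue_measure R) \x (@lebesgue_measure R)]_(x in A)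
       (normal2_pdf mu Sigma x)%:E)%E.

(** ** Constants *)

Definition cst_alpha (R : realType) (mu1 mu2 sigma1 sigma2 rho : R) : R :=
  (sigma1 * sigma2 * Num.sqrt (1 - rho ^+ 2))^-1
  * expR (- ((mu1 ^+ 2 * sigma2 ^+ 2 + sigma1 ^+ 2 * mu2 ^+ 2
              - 2 * rho * sigma1 * sigma2 * mu1 * mu2)
             / (2 * sigma1 ^+ 2 * sigma2 ^+ 2 * (1 - rho ^+ 2)))).

Definition cst_beta (R : realType) (sigma1 sigma2 rho : R) : R :=
  (sigma1 ^+ 2 + sigma2 ^+ 2)
  / (4 * sigma1 ^+ 2 * sigma2 ^+ 2 * (1 - rho ^+ 2)).

Definition cst_eta (R : realType) (sigma1 sigma2 rho : R) : R :=
  Num.sqrt ((sigma2 ^+ 2 - sigma1 ^+ 2) ^+ 2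
            + 4 * sigma1 ^+ 2 * sigma2 ^+ 2 * rho ^+ 2)
  / (4 * sigma1 ^+ 2 * sigma2 ^+ 2 * (1 - rho ^+ 2)).

Definition cst_psi (R : realType) (mu1 mu2 sigma1 sigma2 rho : R) : R :=
  Num.sqrt (sigma1 ^+ 2 * (rho * mu1 * sigma2 - mu2 * sigma1) ^+ 2
            + sigma2 ^+ 2 * (rho * mu2 * sigma1 - mu1 * sigma2) ^+ 2)
  / (sigma1 ^+ 2 * sigma2 ^+ 2 * (1 - rho ^+ 2)).

Definition phit_denom (R : realType) (mu1 mu2 sigma1 sigma2 rho : R) : R :=
  Num.sqrt (mu1 ^+ 2 * sigma2 ^+ 4 + mu2 ^+ 2 * sigma1 ^+ 4
            + rho ^+ 2 * sigma1 ^+ 2 * sigma2 ^+ 2 * (mu1 ^+ 2 + mu2 ^+ 2)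
            - 2 * rho * mu1 * mu2 * sigma1 * sigma2
              * (sigma1 ^+ 2 + sigma2 ^+ 2)).

(* The angle is arbitrary when the denominator vanishes. *)
Definition is_phit (R : realType) (mu1 mu2 sigma1 sigma2 rho phit : R) : Prop :=
  let D := phit_denom mu1 mu2 sigma1 sigma2 rho in
  D != 0 ->
  cos phit = (mu2 * sigma1 ^+ 2 - rho * mu1 * sigma1 * sigma2) / D /\
  sin phit = (mu1 * sigma2 ^+ 2 - rho * mu2 * sigma1 * sigma2) / D.

Definition phi_denom (R : realType) (sigma1 sigma2 rho : R) : R :=
  Num.sqrt ((sigma1 ^+ 2 - sigma2 ^+ 2) ^+ 2
            + 4 * rho ^+ 2 * sigma1 ^+ 2 * sigma2 ^+ 2).

Definition is_phi (R : realType) (sigma1 sigma2 rho phi : R) : Prop :=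
  let E := phi_denom sigma1 sigma2 rho in
  E != 0 ->
  cos phi = (sigma2 ^+ 2 - sigma1 ^+ 2) / E /\
  sin phi = (2 * rho * sigma1 * sigma2) / E.

(** ** Terms of the expansion *)

Definition eps_coef (R : realType) (j : nat) : R := if j == 0%N then 1 else 2.

Definition ell (k1 k2 j : nat) : nat := (k1 + 2 * k2 + 2 * j)%N.

Definition coef_term (R : realType) (k1 k2 j : nat) (psi eta : R) : R :=
  (psi ^+ (2 * k1) * eta ^+ (2 * k2))
  / (4 ^+ (k1 + k2) * k1`!%:R * (k1 + 2 * j)`!%:R * k2`!%:R * (k2 + j)`!%:R).

Definition calI (R : realType) (beta : R) (m : nat) (t : R) : R :=
  Gamma ((m%:R + 1) / 2) / (2 * beta `^ ((m%:R + 1) / 2))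
    * hyp1F1 ((m%:R + 1) / 2) (1 / 2) (t ^+ 2 / (4 * beta))
  + t * (Gamma (m%:R / 2 + 1) / (2 * beta `^ (m%:R / 2 + 1)))
    * hyp1F1 (m%:R / 2 + 1) (3 / 2) (t ^+ 2 / (4 * beta)).

(* Main.v *)
Require Import Defs.
From HB Require Import structures.
From mathcomp Require Import all_boot all_order all_algebra.
From mathcomp Require Import all_classical all_reals all_analysis.
From mathcomp Require Import measurable_realfun zify ring lra.

(**
In polar coordinates the density of [X] at [(r cos omega, r sin omega)] is
[a / (2 pi) * exp (- b r^2) * exp (A cos (2 u - 2 delta) + B cos u)] with
[A = e r^2], [B = p r] and [u = omega + phit - pi / 2] (lemma
[normal2_pdf_polar]): the eigenvalues of the inverse covariance matrix have
half-sum and half-difference [2 b] and [2 e], and [p] is the length of the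
linear term of the exponent. Hence the moment generating function of the radius
is [a / (2 pi)] times the integral over [r >= 0] of
[r exp (t r - b r^2)] times the angular integral of
[exp (A cos (2 u - 2 delta) + B cos u)] over one turn ([mgf_radius]).

Angular integral. Both factors [exp (A cos v)] and [exp (B cos u)] are expanded
in modes: [exp (A cos v)] is the sum over [q, q'] of
[(A/2)^q/q! (A/2)^q'/q'!] times the exponential of [i (q - q') v]. Over a full
turn only the modes with [p + 2 q = p' + 2 q'] survive ([integral_cos_fold]), so
that three free indices are left: [j = |q - q'|], which gives
[eps_j cos (2 j delta)], the smaller of [q, q'], which is [k2], and the smaller
of [p, p'], which is [k1]. The signs of the cosines hinder the rearrangement of
the fourfold sum. They disappear when the integral for [delta = 0] is added,
since [1 + cos (2 j delta) >= 0]; sums and integrals may then be exchanged by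
Tonelli ([angularD_series], [integral_polar_kernelD]), and the integral for
[delta = 0] is half of its own double ([radial_expansion]).

Radial integral. It remains to integrate [r^m exp (t r - b r^2)] with
[m = 2 l + 1], which is [calI b m t] ([calI_integral]): expand [exp (t r)] and
use that the Gaussian moments are values of the Gamma function at half-integers;
even and odd powers of [t] give the two Kummer functions. Everything is finite
because [A + B = e r^2 + p r] and [e < b] ([cst_eta_lt_beta]), that is, because
the covariance matrix is positive definite.

The Laguerre form follows from Kummer's transformation, which is the Cauchy
product of two power series combined with the Chu-Vandermonde identity
([kummer_transformation], [calI_Laguerre]).
*)

Set Implicit Arguments.
Unset Strict Implicit.
Unset Printing Implicit Defensive.

Import Order.TTheory GRing.Theory Num.Theory.
Import numFieldTopology.Exports numFieldNormedType.Exports.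

Local Open Scope classical_set_scope.
Local Open Scope ring_scope.

(** * Series of nonnegative terms *)

Section nneseries_more.
Context {R : realType}.
Local Open Scope ereal_scope.

Lemma nneseries_upto (f : nat -> \bar R) n : (forall i, 0 <= f i) ->
  \sum_(i <oo | (i < n)%N) f i = \sum_(i < n) f i.
Proof.
move=> f0; rewrite eseries_mkcond.
rewrite (nneseries_split 0 n)/=; last by move=> k _; case: ifP.
rewrite add0n eseries0 ?adde0; last by move=> i ni _; rewrite ltnNge ni.
by rewrite big_mkord; apply: eq_bigr => i _; rewrite ltn_ord.
Qed.

Lemma nneseries_from (f : nat -> \bar R) n : (forall i, 0 <= f i) ->
  \sum_(i <oo | (n <= i)%N) f i = \sum_(i <oo) f (n + i)%N.
Proof.
move=> f0; rewrite -ereal_series -(nneseries_addn n)//.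
by apply: eq_eseriesr => i _; rewrite addnC.
Qed.

(** Tonelli for [f i (n - i)], extended by [0] to [n < i]: the row [i] of this
    array is [f i] shifted by [i]. *)
Lemma nneseries_diag (f : nat -> nat -> \bar R) : (forall i j, 0 <= f i j) ->
  \sum_(n <oo) \sum_(i < n.+1) f i (n - i)%N = \sum_(i <oo) \sum_(j <oo) f i j.
Proof.
move=> f0.
transitivity (\sum_(n <oo) \sum_(i <oo)
    (if (i < n.+1)%N then f i (n - i)%N else 0)).
  apply: eq_eseriesr => n _.
  by rewrite -(@nneseries_upto (fun i => f i (n - i)%N))// eseries_mkcond.
rewrite nneseries_interchange; last by move=> i j; case: ifP.
apply: eq_eseriesr => i _; rewrite -eseries_mkcond nneseries_from//.
by apply: eq_eseriesr => j _; rewrite addKn.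
Qed.

Lemma nneseries_pick (f : nat -> \bar R) n : (forall i, 0 <= f i) ->
  \sum_(i <oo | i == n) f i = f n.
Proof.
move=> f0; rewrite eseries_mkcond (nneseries_split 0 n.+1)/=; last first.
  by move=> k _; case: ifP.
rewrite add0n eseries0 ?adde0; last by move=> i ni _; rewrite gtn_eqF.
rewrite big_mkord big_ord_recr/= eqxx big1 ?add0e// => i _.
by rewrite ltn_eqF.
Qed.

(** The pairs with [j <= i] and those with [i < j] are summed separately, in
    terms of the smaller index and of the distance; a distance [j > 0] occurs on
    both sides and the distance [0] only on the first. *)
Lemma nneseries_dist (f : nat -> nat -> \bar R) : (forall i j, 0 <= f i j) ->
  \sum_(i <oo) \sum_(j <oo) f i j =
  \sum_(j <oo) \sum_(k <oo)
    (if j == 0%N then f k k else f (k + j)%N k + f k (k + j)%N).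
Proof.
move=> f0.
have -> : \sum_(i <oo) \sum_(j <oo) f i j =
    \sum_(i <oo) \sum_(j <oo | (j <= i)%N) f i j +
    \sum_(i <oo) \sum_(j <oo | (i < j)%N) f i j.
  rewrite -nneseriesD; try by move=> i _ _; exact: nneseries_ge0.
  apply: eq_eseriesr => i _; rewrite [X in _ = X + _]eseries_mkcond.
  rewrite [X in _ + X]eseries_mkcond -nneseriesD;
    try by move=> j _ _; case: ifP.
  by apply: eq_eseriesr => j _; case: ltnP => _; rewrite ?adde0 ?add0e.
have -> : \sum_(i <oo) \sum_(j <oo | (j <= i)%N) f i j =
    \sum_(j <oo) \sum_(k <oo) f (k + j)%N k.
  transitivity (\sum_(i <oo) \sum_(j <oo) (if (j <= i)%N then f i j else 0)).
    by apply: eq_eseriesr => i _; rewrite eseries_mkcond.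
  rewrite nneseries_interchange; last by move=> i j; case: ifP.
  rewrite [RHS]nneseries_interchange//; apply: eq_eseriesr => k _.
  rewrite -eseries_mkcond (@nneseries_from (f^~ k))//.
have -> : \sum_(i <oo) \sum_(j <oo | (i < j)%N) f i j =
    \sum_(j <oo) \sum_(k <oo) (if j == 0%N then 0 else f k (k + j)%N).
  transitivity (\sum_(i <oo) \sum_(j <oo) f i (i.+1 + j)%N).
    by apply: eq_eseriesr => i _; rewrite nneseries_from.
  rewrite nneseries_interchange// [RHS]nneseries_recl//; last first.
    by move=> j _; apply: nneseries_ge0 => k _ _; case: ifP.
  rewrite [X in X + _]eseries0// add0e -(nneseries_addn 1); last first.
    by move=> j; apply: nneseries_ge0 => k _ _; case: ifP.
  by apply: eq_eseriesr => j _; apply: eq_eseriesr => k _;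
    rewrite addn1/= addSnnS.
rewrite -nneseriesD; last 2 first.
- by move=> j _ _; exact: nneseries_ge0.
- by move=> j _ _; apply: nneseries_ge0 => k _ _; case: ifP.
apply: eq_eseriesr => j _; rewrite -nneseriesD//; last first.
  by move=> k _ _; case: ifP.
apply: eq_eseriesr => k _; case: eqP => [->|//].
by rewrite addn0 adde0.
Qed.

(** Rearrangements take place in [\bar R], convergence is stated in [R]; this is
    the passage between them. *)
Lemma nnseries_cvgP (u : nat -> R) (l : R) : (forall n, (0 <= u n)%R) ->
  \sum_(n <oo) (u n)%:E = l%:E <-> series u @ \oo --> l.
Proof.
move=> u0.
have sE : (fun n => \sum_(0 <= i < n) (u i)%:E) = EFin \o series u.
  by apply/funext => n /=; rewrite sumEFin.
have cu : cvgn (fun n => \sum_(0 <= i < n) (u i)%:E).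
  by apply: is_cvg_nneseries => n _ _; rewrite lee_fin.
split => [h|h].
  suff /fine_cvgP[_] : EFin \o series u @ \oo --> l%:E by [].
  by rewrite -sE -h.
by apply/cvg_lim => //; rewrite sE; apply: cvg_EFin => //; exact: nearW.
Qed.

End nneseries_more.

(** * Cauchy products *)

Section cauchy_product.
Context {R : realType}.
Implicit Types u v : nat -> R.

Definition convolution u v (n : nat) : R := \sum_(i < n.+1) u i * v (n - i)%N.

(** The convolution sums over the triangle [i + j < N] inside the square. The
    rest is dominated by the same expression for the absolute values, whence the
    signed Cauchy product follows from the nonnegative one. *)
Lemma convolution_square u v N :
  series u N * series v N - series (convolution u v) N =
  \sum_(i < N) \sum_(j < N | (N <= i + j)%N) u i * v j.
Proof.
have -> : series (convolution u v) N =
    \sum_(i < N) \sum_(j < N | (i + j < N)%N) u i * v j.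
  rewrite seriesEord /=.
  transitivity (\sum_(n < N) \sum_(i < N | (i <= n)%N) u i * v (n - i)%N).
    apply: eq_bigr => n _; rewrite /convolution.
    by rewrite (big_ord_widen N (fun i => u i * v (n - i)%N)).
  rewrite (exchange_big_dep xpredT)//=; apply: eq_bigr => i _.
  rewrite -(big_mkord (fun n => (i <= n)%N) (fun n => u i * v (n - i)%N)).
  rewrite -(big_mkord (fun j => (i + j < N)%N) (fun j => u i * v j)).
  transitivity (\sum_(i <= n < N) u i * v (n - i)%N).
    by rewrite [RHS](big_nat_widenl _ 0).
  rewrite -[X in \sum_(X <= _ < _) _]add0n big_addn.
  under eq_bigr => j _ do rewrite addnK.
  rewrite (big_nat_widen _ _ N)//=; last exact: leq_subr.
  by apply: eq_bigl => j; rewrite ltn_subRL.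
rewrite !seriesEord /= big_distrlr/= -sumrB; apply: eq_bigr => i _.
rewrite (bigID (fun j : 'I_N => (i + j < N)%N))/= addrAC subrr add0r.
by apply: eq_bigl => j; rewrite -leqNgt.
Qed.

(** Tonelli, antidiagonal by antidiagonal. *)
Lemma cvg_convolution_norm u v :
  cvgn [normed series u] -> cvgn [normed series v] ->
  series (convolution (Num.norm \o u) (Num.norm \o v)) @ \oo -->
  limn [normed series u] * limn [normed series v].
Proof.
move=> cu cv; apply/nnseries_cvgP.
  by move=> n; apply: sumr_ge0 => i _; rewrite mulr_ge0 /=.
have /nnseries_cvgP su := cu; have /nnseries_cvgP sv := cv.
transitivity (\sum_(n <oo) \sum_(i < n.+1) (`|u i| * `|v (n - i)%N|)%:E)%E.
  by apply: eq_eseriesr => n _; rewrite sumEFin.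
rewrite (@nneseries_diag _ (fun i j => (`|u i| * `|v j|)%:E)); last first.
  by move=> i j; rewrite lee_fin mulr_ge0.
transitivity (\sum_(i <oo) ((limn [normed series v])%:E * `|u i|%:E))%E.
  apply: eq_eseriesr => i _; under eq_eseriesr do rewrite EFinM.
  by rewrite nneseriesZl// sv//= muleC.
by rewrite nneseriesZl// su//= muleC.
Qed.

Lemma cvg_convolution u v :
  cvgn [normed series u] -> cvgn [normed series v] ->
  series (convolution u v) @ \oo --> limn (series u) * limn (series v).
Proof.
move=> cu cv.
pose D (a b : nat -> R) N := series a N * series b N - series (convolution a b) N.
have D0 : D (Num.norm \o u) (Num.norm \o v) @ \oo --> (0 : R).
  rewrite -(subrr (limn [normed series u] * limn [normed series v])).
  by apply: cvgB; [exact: cvgM|exact: cvg_convolution_norm].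
have {}D0 : D u v @ \oo --> (0 : R).
  apply/norm_cvg0P; apply: (squeeze_cvgr _ (cvg_cst 0) D0).
  apply: nearW => N; rewrite normr_ge0/= /D !convolution_square.
  apply: (le_trans (ler_norm_sum _ _ _)); apply: ler_sum => i _.
  apply: (le_trans (ler_norm_sum _ _ _)); apply: ler_sum => j _.
  by rewrite normrM.
have -> : series (convolution u v) = series u * series v - D u v.
  by apply/funext => N; rewrite /D !fctE opprB addrC subrK.
rewrite -[X in _ --> X]subr0.
by apply: cvgB => //; apply: cvgM; exact: normed_cvg.
Qed.

End cauchy_product.

(** * Rising factorials and Kummer's transformation *)

Section rising_factorial.
Context {R : realType}.
Implicit Types a b c z : R.

Lemma rising0 a : rising a 0 = 1.
Proof. by rewrite /rising big_ord0. Qed.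

Lemma risingS a n : rising a n.+1 = rising a n * (a + n%:R).
Proof. by rewrite /rising big_ord_recr. Qed.

Lemma risingD a m n : rising a (m + n) = rising a m * rising (a + m%:R) n.
Proof.
elim: n => [|n ih]; first by rewrite addn0 rising0 mulr1.
by rewrite addnS !risingS ih -mulrA natrD addrA.
Qed.

Lemma risingSl a n : rising a n.+1 = a * rising (a + 1) n.
Proof. by rewrite -add1n risingD risingS rising0 mul1r addr0. Qed.

Lemma rising_gt0 b n : 0 < b -> 0 < rising b n.
Proof. by move=> b0; apply: prodr_gt0 => i _; rewrite ltr_wpDr. Qed.

(** Bounds the quotient of two rising factorials geometrically, so that an
    exponential series dominates Kummer's. *)
Lemma normr_rising_le a b n : 0 < b ->
  `|rising a n| <= (1 + `|a| / b) ^+ n * rising b n.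
Proof.
move=> b0; elim: n => [|n ih]; first by rewrite !rising0 normr1 mulr1.
rewrite !risingS normrM exprSr mulrACA ler_pM//.
rewrite (le_trans (ler_normD _ _))// normr_nat mulrDl mul1r mulrDr.
rewrite divfK ?gt_eqF//.
have : 0 <= `|a| / b * n%:R by rewrite mulr_ge0// divr_ge0// ltW.
lra.
Qed.

(** Pascal's rule, as one step of iterated differences. *)
Lemma sum_binS_alternating (F : nat -> R) n :
  \sum_(k < n.+2) 'C(n.+1, k)%:R * (-1) ^+ k * F k =
  \sum_(k < n.+1) 'C(n, k)%:R * (-1) ^+ k * (F k - F k.+1).
Proof.
rewrite big_ord_recl bin0/=.
under eq_bigr => i _ do rewrite /bump/= add1n binS natrD 2!mulrDl.
rewrite big_split/= addrA.
under [RHS]eq_bigr do rewrite mulrBr.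
rewrite [RHS]sumrB; congr (_ + _); last first.
  by rewrite -sumrN; apply: eq_bigr => i _; rewrite exprS mulN1r mulrN mulNr.
rewrite [RHS]big_ord_recl bin0/=; congr (_ + _).
by rewrite big_ord_recr/= bin_small// !mul0r addr0.
Qed.

(** In the induction, one difference in [k] of the summand for [n.+1] and [b] is
    [b - c] times the summand for [n] and [b + 1]. *)
Lemma chu_vandermonde b c n :
  \sum_(k < n.+1) 'C(n, k)%:R * (-1) ^+ k
                  * (rising c k * rising (b + k%:R) (n - k)) =
  rising (b - c) n.
Proof.
elim: n b => [|n ih] b.
  by rewrite big_ord_recl big_ord0 bin0 subnn !rising0 expr0 !mulr1 addr0.
rewrite (sum_binS_alternating
  (fun k => rising c k * rising (b + k%:R) (n.+1 - k))).
have -> : rising (b - c) n.+1 = (b - c) * rising (b + 1 - c) n.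
  by rewrite risingSl addrAC.
rewrite -ih mulr_sumr; apply: eq_bigr => k _.
have kn : (k <= n)%N by rewrite -ltnS.
rewrite subSn// subSS (risingS c).
have -> : rising (b + k%:R) (n - k).+1 =
    (b + k%:R) * rising (b + 1 + k%:R) (n - k).
  by rewrite risingSl addrAC.
rewrite -(addn1 k) natrD addrA (addrAC b 1).
ring.
Qed.

End rising_factorial.

Section kummer.
Context {R : realType}.
Implicit Types a b z : R.

Definition hyp1F1_term a b z (n : nat) : R :=
  rising a n / rising b n * (z ^+ n / n`!%:R).

Lemma is_cvg_hyp1F1_norm a b z : 0 < b ->
  cvgn [normed series (hyp1F1_term a b z)].
Proof.
move=> b0; set K := 1 + `|a| / b.
have K0 : 0 <= K by rewrite addr_ge0// divr_ge0// ltW.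
apply: (@series_le_cvg _ _ (exp_coeff (K * `|z|))).
- by move=> n; exact: normr_ge0.
- by move=> n; rewrite /exp_coeff/= divr_ge0// exprn_ge0// mulr_ge0.
- move=> n; rewrite /exp_coeff/= /hyp1F1_term normrM normrM normfV.
  rewrite (gtr0_norm (rising_gt0 n b0)) normrM normrX normfV normr_nat.
  rewrite exprMn -[leRHS]mulrA ler_wpM2r ?divr_ge0 ?exprn_ge0//.
  by rewrite ler_pdivrMr ?rising_gt0// normr_rising_le.
- exact: is_cvg_series_exp_coeff.
Qed.

Lemma cvg_hyp1F1 a b z : 0 < b ->
  series (hyp1F1_term a b z) @ \oo --> hyp1F1 a b z.
Proof. by move=> b0; exact/normed_cvg/is_cvg_hyp1F1_norm. Qed.

(** The coefficient of [z ^+ n] is the Chu-Vandermonde sum with [c = b - a]. *)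
Lemma convolution_hyp1F1 a b z : 0 < b ->
  convolution (hyp1F1_term (b - a) b (- z)) (exp_coeff z) = hyp1F1_term a b z.
Proof.
move=> b0; apply/funext => n; rewrite /convolution /hyp1F1_term /exp_coeff/=.
rewrite -[X in rising X n / _](subKr b) -chu_vandermonde.
rewrite !mulr_suml; apply: eq_bigr => k _.
have kn : (k <= n)%N by rewrite -ltnS.
move: (nat_of_ord k) kn => {}k kn.
have -> : rising b n = rising b k * rising (b + k%:R) (n - k).
  by rewrite -risingD subnKC.
have -> : z ^+ n = z ^+ k * z ^+ (n - k) by rewrite -exprD subnKC.
rewrite (exprNn z).
have -> : 'C(n, k)%:R = n`!%:R / (k`!%:R * (n - k)`!%:R) :> R.
  by rewrite -(bin_fact kn) !natrM mulfK// mulf_neq0// pnatr_eq0 -lt0n fact_gt0.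
have bk0 : 0 < b + k%:R by rewrite ltr_wpDr.
have /gt_eqF/negbT := rising_gt0 k b0.
have /gt_eqF/negbT := rising_gt0 (n - k) bk0.
have f0 i : i`!%:R != 0 :> R by rewrite pnatr_eq0 -lt0n fact_gt0.
have := f0 n; have := f0 k; have := f0 (n - k)%N.
move: (rising b k) (rising _ (n - k)) => w y n1 n2 n3 n4 n5.
by field; rewrite n1 n2 n3 n4 n5.
Qed.

(** The right-hand side is a product of two absolutely convergent series, whose
    Cauchy product is the left-hand side. *)
Lemma kummer_transformation a b z : 0 < b ->
  hyp1F1 a b z = expR z * hyp1F1 (b - a) b (- z).
Proof.
move=> b0; apply: (@cvg_unique _ (@Rhausdorff R) (series (hyp1F1_term a b z) @ \oo)).
  exact: cvg_hyp1F1.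
rewrite -convolution_hyp1F1// mulrC; apply: cvg_convolution.
  exact: is_cvg_hyp1F1_norm.
by rewrite normed_series_exp_coeff; exact: is_cvg_series_exp_coeff.
Qed.

End kummer.

(** * Changes of variables on the line *)

Section substitution.
Context {R : realType}.
Notation mu := (@lebesgue_measure R).

(** Monotone limit of the substitution rule on compact intervals. An increasing
    union of intervals covers both the substitution [u = x ^+ 2] on the open
    half-line, where the integrand may blow up at [0], and [theta = atan s] on
    the whole line. *)
Lemma ge0_integral_substitution_bigcup (F f G : R -> R) (a b : nat -> R) :
    (forall x : R, is_derive x 1 F (f x)) -> continuous f ->
    nonincreasing_seq a -> nondecreasing_seq b -> (forall k, a k <= b k) ->
    (forall k, {in `[a k, b k] &, {homo F : x y / x < y}}) ->
    (forall k x, x \in `[a k, b k] -> 0 <= f x) ->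
    (forall k y, y \in `[F (a k), F (b k)] -> {for y, continuous G} /\ 0 <= G y) ->
  (\int[mu]_(y in \bigcup_k `[F (a k), F (b k)]%classic) (G y)%:E =
   \int[mu]_(x in \bigcup_k `[a k, b k]%classic) (G (F x) * f x)%:E)%E.
Proof.
move=> dF cf na nb ab incF f0 G0.
have cF : continuous F.
  by move=> x; apply: differentiable_continuous; apply/derivable1_diffP.
have leF k : {in `[a k, b k] &, {homo F : x y / x <= y}}.
  move=> x y xk yk; rewrite le_eqVlt => /predU1P[->//|xy].
  by apply/ltW/(incF k).
have inl k l : (k <= l)%N -> a k \in `[a l, b l].
  by move=> kl; rewrite in_itv/= na//= (le_trans (ab k))// nb.
have inr k l : (k <= l)%N -> b k \in `[a l, b l].
  by move=> kl; rewrite in_itv/= nb// andbT (le_trans _ (ab k))// na.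
have FG k x : x \in `[a k, b k] -> F x \in `[F (a k), F (b k)].
  move=> xk; move: (xk); rewrite !in_itv/= => /andP[ax xb].
  by rewrite (leF k)//= ?(leF k)// ?inl ?inr.
have wG k : {within `[F (a k), F (b k)], continuous G}.
  by apply: continuous_in_subspaceT => x; rewrite inE/= => /G0[].
have wGF k : {within `[a k, b k], continuous (fun x => G (F x) * f x)}.
  apply: continuous_in_subspaceT => x; rewrite inE/= => /FG/G0[cG _].
  apply: cvgM; last exact: cf.
  by apply: continuous_comp; [exact: cF|exact: cG].
have E k : (\int[mu]_(y in `[F (a k), F (b k)]) (G y)%:E =
            \int[mu]_(x in `[a k, b k]) (G (F x) * f x)%:E)%E.
  have F'f : derive1 F = f by apply/funext => x; rewrite derive1E derive_val.
  rewrite integration_by_substitution_increasing//.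
  - by rewrite F'f.
  - by rewrite F'f => x _; exact: cf.
  - by rewrite F'f; apply/cvg_ex; exists (f (a k)); exact/cvg_at_right_filter/cf.
  - by rewrite F'f; apply/cvg_ex; exists (f (b k)); exact/cvg_at_left_filter/cf.
  - split=> //.
    + exact/cvg_at_right_filter/cF.
    + exact/cvg_at_left_filter/cF.
have L1 : ((fun k => \int[mu]_(y in `[F (a k), F (b k)]) (G y)%:E)%E @ \oo -->
    \int[mu]_(y in \bigcup_k `[F (a k), F (b k)]%classic) (G y)%:E)%E.
  apply: (@ge0_nondecreasing_set_cvg_integral _ (measurableTypeR R) R
    (fun k => `[F (a k), F (b k)]%classic) (EFin \o G)).
  - move=> k l kl; apply/subsetPset => y/=; rewrite !in_itv/= => /andP[ay yb].
    rewrite (le_trans _ ay) ?(le_trans yb) ?(leF l) ?inl ?inr//.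
      exact: nb.
    exact: na.
  - by [].
  - by move=> k; apply/measurable_EFinP; exact: subspace_continuous_measurable_fun.
  - by move=> k y /G0[_]; rewrite lee_fin.
rewrite -(cvg_lim _ L1)//; apply/cvg_lim => //.
under eq_fun do rewrite E.
apply: (@ge0_nondecreasing_set_cvg_integral _ (measurableTypeR R) R
  (fun k => `[a k, b k]%classic) (EFin \o (fun x => G (F x) * f x))).
- move=> k l kl; apply/subsetPset => y/=; rewrite !in_itv/= => /andP[ay yb].
  by rewrite (le_trans _ ay) ?(le_trans yb) ?na ?nb.
- by [].
- by move=> k; apply/measurable_EFinP; exact: subspace_continuous_measurable_fun.
- move=> k x/= xk; rewrite lee_fin mulr_ge0//; last exact: f0 xk.
  by have [] := G0 _ _ (FG _ _ xk).
Qed.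

End substitution.

Section scaling.
Context {R : realType}.
Notation mu := (@lebesgue_measure R).
Variables (c : R) (G : R -> R).
Hypotheses (c0 : 0 < c) (cG : continuous G) (G0 : forall x, 0 <= G x).

Let derive_scale : derive1 (fun x : R => c * x) = cst c.
Proof. apply/funext => x; rewrite derive1E derive_val; exact: mulr1. Qed.

Let cont_scale : continuous (fun x : R => c * x).
Proof. by move=> x; apply: cvgM; [exact: cvg_cst|exact: cvg_id]. Qed.

Lemma ge0_integral_scale0y :
  (\int[mu]_(x in `[0%R, +oo[) (G x)%:E =
   \int[mu]_(x in `[0%R, +oo[) (G (c * x) * c)%:E)%E.
Proof.
rewrite -[in LHS](mulr0 c).
rewrite (@increasing_ge0_integration_by_substitutiony _ (fun x => c * x))//.
- by apply: eq_integral => x _; rewrite !fctE derive_scale.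
- by move=> x y _ _; rewrite ltr_pM2l.
- by rewrite derive_scale => x _; exact: cvg_cst.
- by rewrite derive_scale; exact: is_cvg_cst.
- by rewrite derive_scale; exact: is_cvg_cst.
- by split => //; exact/cvg_at_right_filter/cont_scale.
- exact: gt0_cvgMry.
- exact: continuous_subspaceT.
Qed.

Lemma ge0_integral_scaleT :
  (\int[mu]_x (G x)%:E = \int[mu]_x (G (c * x) * c)%:E)%E.
Proof.
rewrite (@increasing_ge0_integration_by_substitutionT _ (fun x => c * x))//.
- by apply: eq_integral => x _; rewrite !fctE derive_scale.
- by move=> x y; rewrite ltr_pM2l.
- by rewrite derive_scale => x; exact: cvg_cst.
- by rewrite derive_scale; exact: is_cvg_cst.
- by rewrite derive_scale; exact: is_cvg_cst.
- exact: gt0_cvgMrNy.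
- exact: gt0_cvgMry.
Qed.

End scaling.

(** * Gaussian moments and the Gamma function at half-integers *)

Section gauss_moments.
Context {R : realType}.
Notation mu := (@lebesgue_measure R).

Definition gauss_moment n : R :=
  \int[mu]_(x in `[0, +oo[) (x ^+ n * gauss_fun x).

Lemma continuous_exprM_gauss n : continuous (fun x : R => x ^+ n * gauss_fun x).
Proof.
by move=> x; apply: cvgM; [exact: exprn_continuous|exact: continuous_gauss_fun].
Qed.

Let measurable_exprM_gauss n :
  measurable_fun setT (fun x : R => x ^+ n * gauss_fun x).
Proof. apply: continuous_measurable_fun; exact: continuous_exprM_gauss. Qed.

Let ge0_exprM_gauss n (x : R) : 0 <= x -> 0 <= x ^+ n * gauss_fun x.
Proof. by move=> x0; rewrite mulr_ge0 ?exprn_ge0 ?gauss_fun_ge0. Qed.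

Let is_derive_gauss (x : R) :
  is_derive x 1 (fun x => - (gauss_fun x / 2)) (x * gauss_fun x).
Proof.
rewrite /gauss_fun; apply: trigger_derive.
by rewrite /GRing.scale/=; field.
Qed.

(** [exp (k ^ 2) >= exp k >= k ^ (n + 1) / (n + 1)!]. *)
Let cvg_exprM_gauss n : (k%:R : R) ^+ n * gauss_fun k%:R @[k --> \oo] --> 0.
Proof.
rewrite -cvg_shiftS/=.
apply: (@squeeze_cvgr _ _ _ _ (fun=> 0) (fun k => n.+1`!%:R * harmonic k)).
- apply: nearW => k; rewrite ge0_exprM_gauss//=.
  have k0 : 0 < k.+1%:R :> R by [].
  rewrite ler_pdivlMr// mulrAC -exprSr /gauss_fun expRN ler_pdivrMr ?expR_gt0//.
  rewrite mulrC -ler_pdivrMr ?ltr0n ?fact_gt0//.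
  rewrite (le_trans _ (_ : expR k.+1%:R <= _))//; last first.
    by rewrite ler_expR -natrX ler_nat expnS leq_pmulr// expn1.
  by rewrite (le_trans _ (expR_ge1Dxn n (ltW k0)))// lerDr.
- exact: cvg_cst.
- rewrite -[X in _ --> X](mulr0 n.+1`!%:R); apply: cvgM; first exact: cvg_cst.
  exact: cvg_harmonic.
Qed.

Lemma integral_gauss_moment1 :
  (\int[mu]_(x in `[0%R, +oo[) (x ^+ 1 * gauss_fun x)%:E = (2^-1)%:E)%E.
Proof.
rewrite (@ge0_continuous_FTC2y _ _ (fun x => - (gauss_fun x / 2)) _ 0).
- by rewrite /gauss_fun expr0n oppr0 expR0 mul1r EFinN sub0e oppeK.
- by move=> x x0; exact: ge0_exprM_gauss.
- by apply: continuous_subspaceT; exact: continuous_exprM_gauss.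
- rewrite -oppr0 -(mul0r 2^-1); apply: cvgN; apply: cvgMl.
  exact: cvg_gauss_fun.
- by move=> x _; have [] := is_derive_gauss x.
- apply: cvg_at_right_filter; apply: cvgN; apply: cvgMl.
  exact: continuous_gauss_fun.
- by move=> x _; rewrite derive1E (@derive_val _ _ _ _ _ _ _ (is_derive_gauss x)) expr1.
Qed.

(** Integration by parts on [[0, b]], where [x * gauss_fun x] has the primitive
    [- gauss_fun x / 2] and the boundary term vanishes as [b] grows. The finite
    value [l] is a hypothesis because finiteness propagates by this very
    recursion. *)
Lemma integral_gauss_momentSS n (l : R) :
  (\int[mu]_(x in `[0%R, +oo[) (x ^+ n * gauss_fun x)%:E = l%:E)%E ->
  (\int[mu]_(x in `[0%R, +oo[) (x ^+ n.+2 * gauss_fun x)%:E =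
   (n.+1%:R / 2 * l)%:E)%E.
Proof.
move=> In.
pose I m b := (\int[mu]_(x in `[0%R, b]) (x ^+ m * gauss_fun x)%:E)%E.
have parts (b : R) : 0 < b -> (I n.+2 b = (- (b ^+ n.+1 * gauss_fun b / 2))%:E +
    (n.+1%:R / 2)%:E * I n b)%E.
  move=> b0; rewrite /I.
  have := @integration_by_parts _ (fun x : R => x ^+ n.+1)
    (fun x => - (gauss_fun x / 2)) (fun x => n.+1%:R * x ^+ n)
    (fun x => x * gauss_fun x) 0 b b0.
  under eq_integral do rewrite mulrA -exprSr.
  move=> ->.
  - rewrite expr0n/= mul0r subr0; congr (_ + _)%E.
      by rewrite mulrN mulrA.
    under eq_integral => x _ do rewrite mulrN EFinN.
    rewrite integral_ge0N/=.
      rewrite oppeK -ge0_integralZl//=.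
      - apply: eq_integral => x _; rewrite -EFinM; congr EFin; ring.
      - apply/measurable_EFinP; apply: measurable_funTS.
        exact: measurable_exprM_gauss.
      - by move=> x; rewrite in_itv/= lee_fin => /andP[/ge0_exprM_gauss].
    move=> x; rewrite /= in_itv/= lee_fin => /andP[x0 _].
    by rewrite mulr_ge0 ?divr_ge0 ?gauss_fun_ge0 ?mulr_ge0 ?exprn_ge0.
  - apply: continuous_subspaceT => x; apply: cvgM; first exact: cvg_cst.
    exact: exprn_continuous.
  - split.
    + by move=> x _; exact: exprn_derivable.
    + exact/cvg_at_right_filter/exprn_continuous.
    + exact/cvg_at_left_filter/exprn_continuous.
  - by move=> x _; rewrite exp_derive1.
  - by apply: continuous_subspaceT; exact: (@continuous_exprM_gauss 1).
  - split.
    + by move=> x _; have [] := is_derive_gauss x.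
    + apply: cvg_at_right_filter; apply: cvgN; apply: cvgMl.
      exact: continuous_gauss_fun.
    + apply: cvg_at_left_filter; apply: cvgN; apply: cvgMl.
      exact: continuous_gauss_fun.
  - by move=> x _; rewrite derive1E (@derive_val _ _ _ _ _ _ _ (is_derive_gauss x)).
have cvgI m : I m k.+1%:R @[k --> \oo] -->
    (\int[mu]_(x in `[0%R, +oo[) (x ^+ m * gauss_fun x)%:E)%E.
  rewrite (@cvg_shiftS _ (fun k => I m k%:R)).
  (* With [`|x|] the integrand is nonnegative on the whole line. *)
  have E (D : set (measurableTypeR R)) : D `<=` `[0, +oo[%classic ->
      (\int[mu]_(x in D) (x ^+ m * gauss_fun x)%:E =
       \int[mu]_(x in D) (`|x| ^+ m * gauss_fun x)%:E)%E.
    move=> D0; apply: eq_integral => x; rewrite inE => /D0/=.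
    by rewrite in_itv/= => /andP[x0 _]; rewrite ger0_norm.
  rewrite E//= /I.
  rewrite (_ : (fun k => _) = (fun k : nat =>
      (\int[mu]_(x in `[0%R, k%:R]) (`|x| ^+ m * gauss_fun x)%:E)%E)); last first.
    by apply/funext => k; rewrite E//; exact: subset_itvl.
  apply: ge0_cvgn_integral.
    by move=> x; rewrite mulr_ge0 ?gauss_fun_ge0.
  under eq_fun do rewrite -normrX.
  apply: measurable_funM; last exact: measurable_gauss_fun.
  by apply: measurableT_comp => //; apply: exprn_measurable.
apply: (cvg_unique _ (cvgI n.+2)) => //.
rewrite (_ : (fun k => I n.+2 k.+1%:R) = (fun k =>
    (- (k.+1%:R ^+ n.+1 * gauss_fun k.+1%:R / 2))%:E +
    (n.+1%:R / 2)%:E * I n k.+1%:R)%E); last first.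
  by apply/funext => k; rewrite parts.
rewrite /= -[X in _ --> X]add0e EFinM; apply: cvgeD => //.
  apply: cvg_EFin; first exact: nearW.
  rewrite -oppr0 -(mul0r 2^-1); apply: cvgN; apply: cvgMl.
  by have := cvg_exprM_gauss n.+1; rewrite -cvg_shiftS.
have cI := cvgI n; rewrite In in cI.
exact: (cvgeZl _ cI).
Qed.

End gauss_moments.

Section gauss_moments_gamma.
Context {R : realType}.
Notation mu := (@lebesgue_measure R).
Notation gauss_moment := (@gauss_moment R).

Let integral_gauss_moment0 :
  (\int[mu]_(x in `[0%R, +oo[) (x ^+ 0 * gauss_fun x)%:E =
   (Num.sqrt pi / 2)%:E)%E.
Proof.
by rewrite -integral0y_gauss; apply: eq_integral => x _; rewrite expr0 mul1r.
Qed.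

Let finite_gauss_moment n : exists l,
  (\int[mu]_(x in `[0%R, +oo[) (x ^+ n * gauss_fun x)%:E = l%:E)%E.
Proof.
suff [] : (exists l,
    (\int[mu]_(x in `[0%R, +oo[) (x ^+ n * gauss_fun x)%:E = l%:E)%E) /\
  (exists l,
    (\int[mu]_(x in `[0%R, +oo[) (x ^+ n.+1 * gauss_fun x)%:E = l%:E)%E) by [].
elim: n => [|n [[l hl] hS]].
  split; first by eexists; exact: integral_gauss_moment0.
  by eexists; exact: integral_gauss_moment1.
by split => //; eexists; exact: integral_gauss_momentSS hl.
Qed.

Lemma integral_gauss_moment n :
  (\int[mu]_(x in `[0%R, +oo[) (x ^+ n * gauss_fun x)%:E =
   (gauss_moment n)%:E)%E.
Proof. by have [l E] := finite_gauss_moment n; rewrite /gauss_moment /Rintegral E. Qed.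

Lemma gauss_moment0 : gauss_moment 0 = Num.sqrt pi / 2.
Proof. by apply: EFin_inj; rewrite -integral_gauss_moment integral_gauss_moment0. Qed.

Lemma gauss_moment1 : gauss_moment 1 = 2^-1.
Proof. by apply: EFin_inj; rewrite -integral_gauss_moment integral_gauss_moment1. Qed.

Lemma gauss_momentSS n : gauss_moment n.+2 = n.+1%:R / 2 * gauss_moment n.
Proof.
apply: EFin_inj; rewrite -integral_gauss_moment.
exact/integral_gauss_momentSS/integral_gauss_moment.
Qed.

Lemma gauss_moment_gt0 n : 0 < gauss_moment n.
Proof.
suff [] : 0 < gauss_moment n /\ 0 < gauss_moment n.+1 by [].
elim: n => [|n [h hS]]; last by rewrite gauss_momentSS; split => //; rewrite mulr_gt0.
by rewrite gauss_moment0 gauss_moment1 divr_gt0 ?sqrtr_gt0 ?pi_gt0.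
Qed.

Let bigcup_itv0y (e : nat) : (0 < e)%N ->
  \bigcup_k `[(k.+1%:R^-1 : R) ^+ e, (k.+1%:R : R) ^+ e]%classic = `]0, +oo[%classic.
Proof.
move=> e0; apply/seteqP; split=> [x [k _]|x]/=; rewrite !in_itv/= andbT.
  by case/andP => + _; apply: lt_le_trans; rewrite exprn_gt0 ?invr_gt0.
move=> x0; pose k := Num.trunc (x + x^-1).
have xk : x + x^-1 < k.+1%:R.
  exact: truncnS_gt.
have k1 : 1 <= k.+1%:R :> R by rewrite ler1n.
exists k => //=; rewrite in_itv/=; apply/andP; split.
  rewrite (@le_trans _ _ k.+1%:R^-1)//.
    by rewrite ler_iXnr // ?invr_ge0 // invf_le1.
  rewrite invf_ple ?posrE// (le_trans _ (ltW xk))// lerDr ltW//.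
rewrite (@le_trans _ _ k.+1%:R)//; last by rewrite ler_eXnr.
by rewrite (le_trans _ (ltW xk))// lerDl invr_ge0 ltW.
Qed.

(** Euler's integral under the substitution [u = x ^+ 2]; the recursion for the
    Gaussian moments then becomes the functional equation of [Gamma]. *)
Lemma Gamma_half n : Gamma ((n%:R + 1) / 2) = 2 * gauss_moment n.
Proof.
rewrite /Gamma ifT ?divr_gt0 ?ltr_wpDl// /Gamma_pos /Rintegral.
rewrite -(@bigcup_itv0y 2)//.
have dF (x : R) : is_derive x 1 (fun x => x ^+ 2) (2 * x).
  by apply: trigger_derive; rewrite /GRing.scale/=; ring.
rewrite (@ge0_integral_substitution_bigcup R (fun x => x ^+ 2) (fun x => 2 * x)
  (fun u => u `^ ((n%:R + 1) / 2 - 1) * expR (- u))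
  (fun k => k.+1%:R^-1) (fun k => k.+1%:R) dF); first last.
- move=> k y; rewrite in_itv/= => /andP[ky _].
  have y0 : 0 < y by apply: lt_le_trans ky; rewrite exprn_gt0// invr_gt0.
  split; last by rewrite mulr_ge0 ?powR_ge0 ?expR_ge0.
  apply: cvgM.
    have : derivable (fun u : R => u `^ ((n%:R + 1) / 2 - 1)) y 1.
      by apply: derivable_powR; rewrite in_itv/= y0.
    by move/derivable1_diffP/differentiable_continuous.
  apply: continuous_comp; first exact: continuousN.
  exact: continuous_expR.
- move=> k x; rewrite in_itv/= => /andP[kx _].
  by rewrite mulr_ge0// (le_trans _ kx)// invr_ge0.
- move=> k x y; rewrite !in_itv/= => /andP[kx _] _ xy.
  have x0 : 0 <= x by rewrite (le_trans _ kx)// invr_ge0.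
  by rewrite ltr_pXn2r// nnegrE// (le_trans x0)// ltW.
- by move=> k; rewrite (@le_trans _ _ 1)// ?ler1n// invf_le1// ler1n.
- by move=> k l kl; rewrite ler_nat.
- by move=> k l kl; rewrite lef_pV2 ?posrE// ler_nat.
- by move=> x; apply: cvgM; [exact: cvg_cst|exact: cvg_id].
have := @bigcup_itv0y 1 isT.
under [X in X = _ -> _]eq_bigcupr do rewrite !expr1.
move=> ->.
have -> : (\int[mu]_(x in `]0%R, +oo[)
     ((x ^+ 2) `^ ((n%:R + 1) / 2 - 1) * expR (- x ^+ 2) * (2 * x))%:E =
   2%:E * \int[mu]_(x in `[0%R, +oo[) (x ^+ n * gauss_fun x)%:E)%E.
  have mg : measurable_fun setT (EFin \o (fun x : R => x ^+ n * gauss_fun x)).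
    apply/measurable_EFinP; apply: continuous_measurable_fun.
    exact: continuous_exprM_gauss.
  rewrite -integral_itv_obnd_cbnd; last exact: measurable_funTS mg.
  rewrite -ge0_integralZl//=; last 2 first.
  - exact: measurable_funTS mg.
  - move=> x; rewrite in_itv/= andbT lee_fin => /ltW x0.
    by rewrite mulr_ge0 ?exprn_ge0 ?gauss_fun_ge0.
  apply: eq_integral => x; rewrite inE/= in_itv/= andbT => x0.
  rewrite -EFinM; congr EFin; rewrite /gauss_fun.
  have -> : (x ^+ 2) `^ ((n%:R + 1) / 2 - 1) = x `^ (2 * ((n%:R + 1) / 2 - 1)).
    by rewrite powRrM powR_mulrn// ltW.
  have -> : x ^+ n = x `^ (2 * ((n%:R + 1) / 2 - 1)) * x.
    rewrite -[X in _ = _ * X]powRr1; last exact: ltW.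
    rewrite -powRD; last by rewrite (gt_eqF x0) implybT.
    by rewrite -powR_mulrn; [congr (_ `^ _); field|exact: ltW].
  ring.
by rewrite integral_gauss_moment.
Qed.

Lemma Gamma_half_gt0 n : 0 < Gamma ((n%:R + 1) / 2 : R).
Proof. by rewrite Gamma_half mulr_gt0// gauss_moment_gt0. Qed.

Lemma Gamma_halfSS n :
  Gamma ((n.+2%:R + 1) / 2 : R) = (n%:R + 1) / 2 * Gamma ((n%:R + 1) / 2).
Proof. by rewrite !Gamma_half gauss_momentSS natr1 mulrCA. Qed.

Lemma integral_exprM_expR_sqr (c : R) n : 0 < c ->
  (\int[mu]_(x in `[0%R, +oo[) (x ^+ n * expR (- (c * x ^+ 2)))%:E =
   (Gamma ((n%:R + 1) / 2) / (2 * c `^ ((n%:R + 1) / 2)))%:E)%E.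
Proof.
move=> c0; set s := Num.sqrt c.
have s0 : 0 < s by rewrite sqrtr_gt0.
have cE : c = s ^+ 2 by rewrite sqr_sqrtr// ltW.
have sn0 : s ^+ n.+1 != 0 by rewrite expf_neq0// gt_eqF.
have -> : c `^ ((n%:R + 1) / 2) = s ^+ n.+1.
  rewrite cE -!powR_mulrn; [|exact: ltW..].
  by rewrite -powRrM mulrCA divff// mulr1 natr1.
rewrite Gamma_half -mulf_div divff// mul1r EFinM -integral_gauss_moment.
(* With [`|x|] the integrand is nonnegative on the whole line. *)
have Enorm (D : set (measurableTypeR R)) (f : R -> R) : D `<=` `[0, +oo[%classic ->
    (\int[mu]_(x in D) (`|x| ^+ n * f x)%:E =
     \int[mu]_(x in D) (x ^+ n * f x)%:E)%E.
  move=> D0; apply: eq_integral => x; rewrite inE => /D0/=.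
  by rewrite in_itv/= => /andP[x0 _]; rewrite ger0_norm.
have cG : continuous (fun x : R => `|x| ^+ n * gauss_fun x).
  move=> x; apply: cvgM; last exact: continuous_gauss_fun.
  apply: (@continuous_comp _ _ _ (fun x : R => `|x|) (fun y : R => y ^+ n)).
    exact: norm_continuous.
  exact: exprn_continuous.
rewrite -(Enorm _ (@gauss_fun R))// (ge0_integral_scale0y s0 cG); last first.
  by move=> x; rewrite mulr_ge0// gauss_fun_ge0.
have -> : (\int[mu]_(x in `[0%R, +oo[) (`|s * x| ^+ n * gauss_fun (s * x) * s)%:E =
  (s ^+ n.+1)%:E * \int[mu]_(x in `[0%R, +oo[) (x ^+ n * expR (- (c * x ^+ 2)))%:E)%E.
  rewrite -ge0_integralZl//=; last 3 first.
  - apply/measurable_EFinP; apply: measurable_funM; first exact: exprn_measurable.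
    apply: measurableT_comp => //; apply: measurableT_comp => //.
    by apply: measurable_funM => //; exact: exprn_measurable.
  - move=> x; rewrite in_itv/= andbT lee_fin => x0.
    by rewrite mulr_ge0 ?exprn_ge0 ?expR_ge0.
  - by rewrite lee_fin exprn_ge0// ltW.
  apply: eq_integral => x; rewrite inE/= in_itv/= andbT => x0.
  rewrite -EFinM normrM (gtr0_norm s0) (ger0_norm x0) /gauss_fun cE !exprMn (exprSr s n).
  by congr EFin; ring.
by rewrite muleAC -EFinM divff// mul1e.
Qed.

End gauss_moments_gamma.

(** * Termwise integration of an exponential series *)

Section expR_series_integral.
Context d (T : measurableType d) {R : realType}.
Variables (mu : {measure set T -> \bar R}) (D : set T) (w Z : T -> R).
Hypotheses (mD : measurable D) (mw : measurable_fun D w)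
  (mZ : measurable_fun D Z) (w0 : forall x, D x -> 0 <= w x)
  (iwZ : mu.-integrable D (fun x => (w x * expR `|Z x|)%:E)).

Let series_le_expR z N : `|series (exp_coeff z) N| <= expR `|z| :> R.
Proof.
rewrite (@le_trans _ _ (series (exp_coeff `|z|) N))//.
  rewrite -normed_series_exp_coeff; exact: ler_norm_sum.
apply: nondecreasing_cvgn_le; last exact: is_cvg_series_exp_coeff.
by apply: nondecreasing_series => n _ _; exact: exp_coeff_ge0.
Qed.

Let term_le_expR z n : `|exp_coeff z n| <= expR `|z| :> R.
Proof.
rewrite /exp_coeff/= normrM normrX normfV normr_nat.
apply: le_trans (_ : series (exp_coeff `|z|) n.+1 <= _); last first.
  have := series_le_expR `|z| n.+1; rewrite normr_id; apply: le_trans.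
  exact: ler_norm.
by rewrite seriesSr/= lerDr; apply: sumr_ge0 => i _; exact: exp_coeff_ge0.
Qed.

Let m_exp_coeff n : measurable_fun D (fun x => w x * exp_coeff (Z x) n).
Proof.
apply: measurable_funM => //; rewrite /exp_coeff/=.
by apply: measurable_funM => //; apply: measurable_funX.
Qed.

Lemma integrable_expR_term n :
  mu.-integrable D (fun x => (w x * (Z x ^+ n / n`!%:R))%:E).
Proof.
apply: le_integrable iwZ => //; first exact/measurable_EFinP/m_exp_coeff.
move=> x Dx; rewrite lee_fin !normrM (ger0_norm (w0 Dx)).
rewrite ler_wpM2l ?w0// (ger0_norm (expR_ge0 _)) -normrM.
exact: term_le_expR.
Qed.

(** Dominated convergence: every partial sum of the exponential series at [Z x]
    is bounded by [expR `|Z x|]. *)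
Lemma cvg_expR_series_integral :
  series (fun n => \int[mu]_(x in D) (w x * (Z x ^+ n / n`!%:R))) @ \oo -->
  \int[mu]_(x in D) (w x * expR (Z x)).
Proof.
pose f_ N x := (w x * series (exp_coeff (Z x)) N)%:E.
have [] := @dominated_convergence _ _ _ mu D mD f_
   (fun x => (w x * expR (Z x))%:E) (fun x => (w x * expR `|Z x|)%:E).
- move=> N; apply/measurable_EFinP.
  rewrite (_ : (fun x => _) = fun x => \sum_(i < N) w x * exp_coeff (Z x) i).
    exact: measurable_sum.
  by apply/funext => x; rewrite seriesEord mulr_sumr.
- apply/measurable_EFinP; apply: measurable_funM => //.
  exact: measurableT_comp.
- apply: aeW => x Dx; apply: cvg_EFin; first exact: nearW.
  by apply: cvgM; [exact: cvg_cst|exact: is_cvg_series_exp_coeff].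
- exact: iwZ.
- apply: aeW => x N Dx; rewrite lee_fin normrM (ger0_norm (w0 Dx)).
  by rewrite ler_wpM2l ?w0.
move=> iE _; rewrite -(fineK (integrable_fin_num mD iE)) => /fine_cvg.
rewrite (_ : fine \o _ =
  series (fun n => \int[mu]_(x in D) (w x * (Z x ^+ n / n`!%:R)))) //.
apply/funext => N /=; rewrite seriesEord/= /Rintegral sum_fine; last first.
  by move=> i _; apply: integrable_fin_num => //; exact: integrable_expR_term.
rewrite -integral_sum//; last exact: integrable_expR_term.
congr fine; apply: eq_integral => x _.
by rewrite /f_ sumEFin seriesEord mulr_sumr.
Qed.

End expR_series_integral.

(** * The radial integrals *)

Section radial_weight.
Context {R : realType}.
Variables (b t : R).

Definition radial_weight (m : nat) (r : R) : R :=
  r ^+ m * expR (t * r - b * r ^+ 2).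

Lemma radial_weight_ge0 m r : 0 <= r -> 0 <= radial_weight m r.
Proof. by move=> r0; rewrite mulr_ge0 ?exprn_ge0 ?expR_ge0. Qed.

Lemma measurable_radial_weight m : measurable_fun setT (radial_weight m).
Proof.
apply: measurable_funM; first exact: exprn_measurable.
apply: measurableT_comp => //; apply: measurable_funB.
  exact: measurable_funM.
by apply: measurable_funM => //; exact: exprn_measurable.
Qed.

End radial_weight.

Section radial_integral.
Context {R : realType}.
Notation mu := (@lebesgue_measure R).
Notation halfline := (`[0%R, +oo[%classic : set (measurableTypeR R)).

Let integrable_gauss_weight (b : R) m : 0 < b ->
  mu.-integrable halfline (EFin \o radial_weight b 0 m).
Proof.
move=> b0; apply/integrableP; split.
  by apply/measurable_EFinP/measurable_funTS; exact: measurable_radial_weight.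
under eq_integral => x.
  rewrite inE/= in_itv/= andbT => x0.
  rewrite ger0_norm ?radial_weight_ge0// /radial_weight mul0r sub0r.
  over.
by rewrite /= integral_exprM_expR_sqr// ltry.
Qed.

(** Completing the square: [t r <= t^2 / (2 b) + b r^2 / 2]. *)
Lemma integrable_radial_weight (b t : R) m : 0 < b ->
  mu.-integrable halfline (EFin \o radial_weight b t m).
Proof.
move=> b0; have b20 : 0 < b / 2 by rewrite divr_gt0.
apply: (@le_integrable _ _ _ mu halfline _ _
  (fun x => (expR (t ^+ 2 / (2 * b)))%:E * (radial_weight (b / 2) 0 m x)%:E)%E).
- by [].
- by apply/measurable_EFinP/measurable_funTS; exact: measurable_radial_weight.
- move=> r; rewrite /= in_itv/= andbT => r0.
  rewrite lee_fin ger0_norm ?radial_weight_ge0//.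
  rewrite ger0_norm ?mulr_ge0 ?expR_ge0 ?radial_weight_ge0//.
  rewrite /radial_weight [leRHS]mulrCA ler_wpM2l ?(exprn_ge0 m r0)//.
  rewrite -expRD ler_expR -subr_ge0.
  have -> : t ^+ 2 / (2 * b) + (0 * r - b / 2 * r ^+ 2) - (t * r - b * r ^+ 2) =
    (b * r - t) ^+ 2 / (2 * b) by field; rewrite gt_eqF.
  by rewrite divr_ge0 ?sqr_ge0// mulr_ge0// ltW.
- by apply: exprn_ge0.
- by apply: (integrableZl _ _ (integrable_gauss_weight m b20)).
Qed.

Lemma Gamma_half_rising m k :
  Gamma (((m + 2 * k)%:R + 1) / 2 : R) =
  rising ((m%:R + 1) / 2) k * Gamma ((m%:R + 1) / 2).
Proof.
elim: k => [|k ih]; first by rewrite muln0 addn0 rising0 mul1r.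
rewrite mulnSr addnA addn2 Gamma_halfSS ih risingS mulrA; congr (_ * _).
by rewrite natrD natrM; field.
Qed.

(** The even factorials produce the lower parameter [1 / 2] of the first Kummer
    function, the odd ones the lower parameter [3 / 2] of the second. *)
Lemma fact_double k :
  (2 * k)`!%:R = 4 ^+ k * k`!%:R * rising (1 / 2) k :> R.
Proof.
elim: k => [|k ih]; first by rewrite muln0 fact0 expr0 rising0 !mulr1.
rewrite mulnS add2n (factS (2 * k).+1) (factS (2 * k)) (factS k).
rewrite natrM (natrM _ _ (2 * k)`!) (natrM _ k.+1) ih exprS risingS.
by rewrite -!natr1 natrM; field.
Qed.

Lemma fact_doubleS k :
  (2 * k).+1`!%:R = 4 ^+ k * k`!%:R * rising (3 / 2) k :> R.
Proof.
elim: k => [|k ih]; first by rewrite muln0 expr0 rising0 !mulr1.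
rewrite mulnS add2n (factS (2 * k).+2) (factS (2 * k).+1) (factS k).
rewrite natrM (natrM _ _ (2 * k).+1`!) (natrM _ k.+1) ih exprS risingS.
by rewrite -!natr1 natrM; field.
Qed.

(** Expand [expR (t * r)] and integrate termwise: the even powers of [t] make up
    the first Kummer function and the odd ones the second. *)
Lemma calI_integral (b t : R) m : 0 < b ->
  calI b m t = \int[mu]_(r in `[0%R, +oo[) radial_weight b t m r.
Proof.
move=> b0; pose u n : R := t ^+ n / n`!%:R *
  (Gamma (((m + n)%:R + 1) / 2) / (2 * b `^ (((m + n)%:R + 1) / 2))).
have iw : mu.-integrable halfline (fun x =>
    (radial_weight b 0 m x * expR `|t * x|)%:E).
  apply: eq_integrable (integrable_radial_weight `|t| m b0) => //.
  move=> x; rewrite inE/= in_itv/= andbT => x0.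
  rewrite /radial_weight normrM (ger0_norm x0) -mulrA -expRD.
  by congr (_ * expR _)%:E; ring.
have mw : measurable_fun halfline (radial_weight b 0 m).
  by apply: measurable_funTS; exact: measurable_radial_weight.
have mZ : measurable_fun halfline (fun x => t * x).
  by apply: measurable_funTS; exact: measurable_funM.
have w0 (x : R) : halfline x -> 0 <= radial_weight b 0 m x.
  by rewrite /= in_itv/= andbT; exact: radial_weight_ge0.
have := @cvg_expR_series_integral _ _ R mu halfline _ _ _ mw mZ w0 iw.
have -> : (fun n => \int[mu]_(x in `[0%R, +oo[)
    (radial_weight b 0 m x * ((t * x) ^+ n / n`!%:R))) = u.
  apply/funext => n; transitivity (\int[mu]_(x in halfline)
      (t ^+ n / n`!%:R * radial_weight b 0 (m + n) x)).
    apply: eq_Rintegral => x _; rewrite /radial_weight exprD exprMn; ring.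
  rewrite RintegralZl//; last exact: integrable_radial_weight.
  congr (_ * _); apply: EFin_inj.
  rewrite -(integral_exprM_expR_sqr _ b0) /Rintegral fineK; last first.
    by apply: integrable_fin_num => //; exact: integrable_radial_weight.
  by apply: eq_integral => x _; rewrite /radial_weight mul0r sub0r.
have -> : \int[mu]_(x in `[0, +oo[) (radial_weight b 0 m x * expR (t * x)) =
   \int[mu]_(r in `[0%R, +oo[) radial_weight b t m r.
  apply: eq_Rintegral => x _; rewrite /radial_weight -mulrA -expRD.
  by congr (_ * expR _); ring.
move=> /(_ (measurable_itv _)) ul.
have f0 n : n`!%:R != 0 :> R by rewrite pnatr_eq0 -lt0n fact_gt0.
have e0 n : (4 : R) ^+ n != 0 by rewrite expf_neq0.
have bk0 n : b ^+ n != 0 by rewrite expf_neq0// gt_eqF.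
have bp0 x : b `^ x != 0 by rewrite gt_eqF// powR_gt0.
have powRb x k : b `^ (x + k%:R) = b `^ x * b ^+ k.
  rewrite powRD; last by rewrite (gt_eqF b0) implybT.
  by rewrite powR_mulrn// ltW.
have r0 (x : R) k : 0 < x -> rising x k != 0.
  by move=> x0; rewrite gt_eqF// rising_gt0.
have ue : u \o (fun k => 2 * k)%N =
  (Gamma ((m%:R + 1) / 2) / (2 * b `^ ((m%:R + 1) / 2))) *:
    (hyp1F1_term ((m%:R + 1) / 2) (1 / 2) (t ^+ 2 / (4 * b)) : nat -> R^o).
  apply/funext => k; rewrite /u /hyp1F1_term !fctE Gamma_half_rising fact_double.
  have -> : ((m + 2 * k)%:R + 1) / 2 = (m%:R + 1) / 2 + k%:R :> R.
    by rewrite natrD natrM; field.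
  rewrite powRb exprM expr_div_n (exprMn _ 4) /GRing.scale/=.
  by field; rewrite f0 e0 bk0 bp0 r0.
have uo : u \o (fun k => (2 * k).+1)%N =
  (t * (Gamma (m%:R / 2 + 1) / (2 * b `^ (m%:R / 2 + 1)))) *:
    (hyp1F1_term (m%:R / 2 + 1) (3 / 2) (t ^+ 2 / (4 * b)) : nat -> R^o).
  apply/funext => k; rewrite /u /hyp1F1_term !fctE addnS -addSn.
  rewrite Gamma_half_rising fact_doubleS.
  have -> : ((m.+1 + 2 * k)%:R + 1) / 2 = (m%:R / 2 + 1) + k%:R :> R.
    by rewrite natrD natrM -natr1; field.
  have -> : (m.+1%:R + 1) / 2 = m%:R / 2 + 1 :> R by rewrite -natr1; field.
  rewrite powRb exprS exprM expr_div_n (exprMn _ 4) /GRing.scale/=.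
  by field; rewrite f0 e0 bk0 bp0 r0.
have ce : series (u \o (fun k => 2 * k)%N) @ \oo -->
   Gamma ((m%:R + 1) / 2) / (2 * b `^ ((m%:R + 1) / 2))
    * hyp1F1 ((m%:R + 1) / 2) (1 / 2) (t ^+ 2 / (4 * b)).
  rewrite ue seriesZ; apply: cvgM; first exact: cvg_cst.
  exact: cvg_hyp1F1.
have co : series (u \o (fun k => (2 * k).+1)%N) @ \oo -->
  t * (Gamma (m%:R / 2 + 1) / (2 * b `^ (m%:R / 2 + 1)))
    * hyp1F1 (m%:R / 2 + 1) (3 / 2) (t ^+ 2 / (4 * b)).
  rewrite uo seriesZ; apply: cvgM; first exact: cvg_cst.
  exact: cvg_hyp1F1.
have /(_ isT) := @cvg_series_cvg_series_group _ u 2 (cvgP _ ul).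
rewrite (cvg_lim _ ul)//; apply: cvg_unique => //.
rewrite [X in X @ _](_ : _ =
    series (u \o (fun k => 2 * k)%N) + series (u \o (fun k => (2 * k).+1)%N)).
  exact: cvgD.
rewrite -seriesD; congr series; apply/funext => k.
transitivity (u (2 * k)%N + u (2 * k).+1); last by [].
by rewrite /= mulSn add2n (mulnC k) big_nat_recr ?leqnSn//= big_nat1.
Qed.

Lemma calI_ge0 (b t : R) m : 0 < b -> 0 <= calI b m t.
Proof.
move=> b0; rewrite calI_integral//; apply: Rintegral_ge0 => r.
by rewrite /= in_itv/= andbT; exact: radial_weight_ge0.
Qed.

End radial_integral.

(** * The Laguerre form of the radial integrals *)

Section laguerre.
Context {R : realType}.

Lemma Gamma_1_2 : Gamma (1 / 2 : R) = Num.sqrt pi.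
Proof.
have -> : 1 / 2 = (0%:R + 1) / 2 :> R by rewrite add0r.
by rewrite Gamma_half gauss_moment0; field.
Qed.

Lemma Gamma_3_2 : Gamma (3 / 2 : R) = Num.sqrt pi / 2.
Proof.
have -> : 3 / 2 = (2%:R + 1) / 2 :> R by field.
by rewrite Gamma_halfSS add0r Gamma_1_2; field.
Qed.

(** Kummer's transformation makes the upper parameters [- (m / 2)] and
    [- ((m - 1) / 2)], as in the Laguerre functions. The Gamma factors of
    these cancel against those of the right-hand side or occur on the left,
    except for [Gamma (1 / 2)] and [Gamma (3 / 2)], which leave [sqrt pi]. *)
Lemma calI_Laguerre (b t : R) (m : nat) : 0 < b ->
  calI b m t =
    Num.sqrt pi * expR (t ^+ 2 / (4 * b)) / (2 * b `^ ((m%:R + 1) / 2))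
    * (Gamma (m%:R / 2 + 1)
         * Laguerre (- (1 / 2)) (m%:R / 2) (- (t ^+ 2 / (4 * b)))
       + t / (2 * Num.sqrt b) * Gamma ((m%:R + 1) / 2)
         * Laguerre (1 / 2) ((m%:R - 1) / 2) (- (t ^+ 2 / (4 * b)))).
Proof.
move=> b0; rewrite /calI /Laguerre; set z := t ^+ 2 / (4 * b).
rewrite (@kummer_transformation _ _ (1 / 2))// (@kummer_transformation _ _ (3 / 2))//.
have -> : m%:R / 2 + - (1 / 2) + 1 = (m%:R + 1) / 2 :> R by field.
have -> : (m%:R - 1) / 2 + 1 / 2 + 1 = m%:R / 2 + 1 :> R by field.
have -> : (m%:R - 1) / 2 + 1 = (m%:R + 1) / 2 :> R by field.
have -> : - (1 / 2) + 1 = 1 / 2 :> R by field.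
have -> : 1 / 2 + 1 = 3 / 2 :> R by field.
have -> : 1 / 2 - (m%:R + 1) / 2 = - (m%:R / 2) :> R by field.
have -> : 3 / 2 - (m%:R / 2 + 1) = - ((m%:R - 1) / 2) :> R by field.
rewrite Gamma_1_2 Gamma_3_2.
have -> : b `^ (m%:R / 2 + 1) = b `^ ((m%:R + 1) / 2) * Num.sqrt b.
  rewrite -powR12_sqrt; last exact: ltW.
  rewrite -powRD; last by rewrite (gt_eqF b0) implybT.
  by congr (_ `^ _); field.
have /gt_eqF/negbT G1 := @Gamma_half_gt0 R m.
have G2 : Gamma (m%:R / 2 + 1 : R) != 0.
  have -> : m%:R / 2 + 1 = (m.+1%:R + 1) / 2 :> R by rewrite -natr1; field.
  exact/negbT/gt_eqF/Gamma_half_gt0.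
have bp : b `^ ((m%:R + 1) / 2) != 0 by rewrite gt_eqF// powR_gt0.
have sb : Num.sqrt b != 0 by rewrite gt_eqF// sqrtr_gt0.
have sp : Num.sqrt (pi : R) != 0 by rewrite gt_eqF// sqrtr_gt0 pi_gt0.
by field; rewrite G1 G2 bp sb sp.
Qed.

End laguerre.

(** * Polar coordinates *)

Section polar.
Context {R : realType}.
Notation mu := (@lebesgue_measure R).
Notation halfline := (`[0%R, +oo[%classic : set (measurableTypeR R)).
Local Notation mR := (measurableTypeR R).

Lemma ge0_integralT_fold (h : R -> R) : continuous h -> (forall x, 0 <= h x) ->
  (\int[mu]_x (h x)%:E = \int[mu]_(x in halfline) (h x + h (- x))%:E)%E.
Proof.
move=> ch h0.
have mh : measurable_fun setT (EFin \o h).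
  by apply/measurable_EFinP; exact: continuous_measurable_fun.
have mhN : measurable_fun setT (fun x : mR => (h (- x))%:E).
  by apply: (measurableT_comp mh).
have -> : [set: mR] = halfline `|` `]-oo, 0%R[%classic.
  by apply/seteqP; split => // x _; rewrite /= !in_itv/= andbT; case: leP; [left|right].
rewrite ge0_integral_setU//=; last 3 first.
- exact: measurable_funTS mh.
- by move=> x _; rewrite lee_fin.
- apply/disj_setPS => x [/=]; rewrite !in_itv/= andbT => x0.
  by rewrite ltNge x0.
rewrite integral_itv_bndo_bndc; last exact: measurable_funTS mh.
have -> : (\int[mu]_(x in `]-oo, 0%R]) (h x)%:E =
           \int[mu]_(x in halfline) (h (- x))%:E)%E.
  rewrite (@ge0_integration_by_substitution0 R (fun x => (h (- x))%:E))//;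
    last by move=> x; rewrite lee_fin.
  by apply: eq_integral => x _; rewrite opprK.
rewrite -ge0_integralD//=.
- by move=> x _; rewrite lee_fin.
- exact: measurable_funTS mh.
- by move=> x _; rewrite lee_fin.
- exact: measurable_funTS mhN.
Qed.

Lemma fubini_tonelli_halfline (k : mR * mR -> R) : measurable_fun setT k ->
    (forall s r, 0 <= r -> 0 <= k (s, r)) ->
  (\int[mu]_s \int[mu]_(r in halfline) (k (s, r))%:E =
   \int[mu]_(r in halfline) \int[mu]_s (k (s, r))%:E)%E.
Proof.
move=> mk k0; pose k' z : \bar R := (k z * \1_halfline z.2)%:E.
have mk' : measurable_fun setT k'.
  apply/measurable_EFinP; apply: measurable_funM => //.
  have mI : measurable_fun setT (\1_halfline : mR -> R).
    exact: measurable_indic.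
  exact: (measurableT_comp mI measurable_snd).
have k'0 z : (0 <= k' z)%E.
  rewrite /k' lee_fin indicE; case: (boolP (_ \in _)); last by rewrite mulr0.
  by rewrite inE/= in_itv/= andbT mulr1; case: z => s r; exact: k0.
transitivity (\int[mu]_s \int[mu]_r k' (s, r))%E.
  apply: eq_integral => s _; rewrite integral_mkcond; apply: eq_integral => r _.
  by rewrite /k' patchE indicE/=; case: ifPn => _; rewrite ?mulr1 ?mulr0.
rewrite (fubini_tonelli k')// [RHS]integral_mkcond.
apply: eq_integral => r _; rewrite patchE/=; case: ifPn => rH.
  by apply: eq_integral => s _; rewrite /k' indicE/= rH mulr1.
rewrite integral0_eq// => s _.
by rewrite /k' indicE/= (negbTE rH) mulr0.
Qed.

(** The points of angles [theta] and [pi - theta]: for [theta] between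
    [- (pi / 2)] and [pi / 2] they cover both halves of the circle. *)
Definition fold_polar (g : R * R -> R) (r theta : R) : R :=
  g (r * cos theta, r * sin theta) + g (- (r * cos theta), r * sin theta).

Variable g : R * R -> R.
Hypotheses (cg : continuous g) (mg : measurable_fun setT (g : mR * mR -> R))
  (g0 : forall z, 0 <= g z).

Let cont_pair (u v : R -> R) : continuous u -> continuous v ->
  continuous (fun x => g (u x, v x)).
Proof.
move=> cu cv x; apply: continuous_comp; last exact: cg.
exact: (cvg_pair (cu x) (cv x)).
Qed.

Let meas_pair (u v : mR * mR -> mR) : measurable_fun setT u ->
  measurable_fun setT v -> measurable_fun setT (fun z => g (u z, v z)).
Proof.
move=> mu_ mv_; apply: (measurableT_comp mg).
exact: measurable_fun_pair.
Qed.

Let cos_atan_gt0 s : 0 < cos (atan s) :> R.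
Proof. by apply: cos_gt0_pihalf; rewrite atan_gtNpi2 atan_ltpi2. Qed.

Let cos_atanM s : s * cos (atan s) = sin (atan s) :> R.
Proof. by rewrite -{1}(atanK s) /tan divfK// gt_eqF. Qed.

Let cos_atan_sqr s : cos (atan s) ^+ 2 = (1 + s ^+ 2)^-1 :> R.
Proof.
rewrite -[LHS]invrK -exprVn -{2}(atanK s) -cos2_tan2 ?exprVn//.
by rewrite gt_eqF.
Qed.

(** [g] in the coordinates [x] and [s], where [y = `|x| * s], with the Jacobian. *)
Let shear (z : mR * mR) : R := `|z.1| * g (z.1, `|z.1| * z.2).

Let measurable_shear : measurable_fun setT shear.
Proof.
apply: measurable_funM; first exact: measurableT_comp.
apply: meas_pair => //; apply: measurable_funM => //.
exact: measurableT_comp.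
Qed.

Let shear_ge0 z : 0 <= shear z.
Proof. by rewrite mulr_ge0. Qed.

Let integral_shear :
  (\int[mu]_x \int[mu]_y (g (x, y))%:E =
   \int[mu]_x \int[mu]_s (shear (x, s))%:E)%E.
Proof.
have mI (h : mR * mR -> R) : measurable_fun setT h -> (forall z, 0 <= h z) ->
    measurable_fun (setT `\ (0 : mR)) (fun x => \int[mu]_y (h (x, y))%:E)%E.
  move=> mh h0; apply: measurable_funTS.
  apply: (measurable_fun_fubini_tonelli_F (EFin \o h)); first exact/measurable_EFinP.
  by move=> z; rewrite lee_fin.
have m0 : measurable (setT `\ (0 : mR)) by exact: measurableD.
rewrite -(@integral_setD1 _ _ 0 setT m0 (mI _ mg g0)).
rewrite -[RHS](@integral_setD1 _ _ 0 setT m0 (mI _ measurable_shear shear_ge0)).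
apply: eq_integral => x; rewrite inE/= => -[_ /eqP x0].
rewrite (@ge0_integral_scaleT _ `|x| (fun y => g (x, y))) ?normr_gt0//.
- by apply: eq_integral => s _; rewrite /shear/= mulrC.
- by apply: cont_pair => y; [exact: cvg_cst|exact: cvg_id].
Qed.

Let integral_ray s :
  (\int[mu]_x (shear (x, s))%:E = \int[mu]_(r in halfline)
     ((1 + s ^+ 2)^-1 * (r * fold_polar g r (atan s)))%:E)%E.
Proof.
have cs : continuous (fun x => shear (x, s)).
  move=> x; apply: cvgM; first exact: norm_continuous.
  apply: (@cont_pair id (fun x : R => `|x| * s)) => y; first exact: cvg_id.
  by apply: cvgM; [exact: norm_continuous|exact: cvg_cst].
rewrite ge0_integralT_fold// (@ge0_integral_scale0y _ (cos (atan s))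
  (fun x => shear (x, s) + shear (- x, s)))//.
- apply: eq_integral => r; rewrite inE/= in_itv/= andbT => r0.
  rewrite /shear/= normrN normrM (ger0_norm r0) gtr0_norm//.
  have -> : cos (atan s) * r * s = r * sin (atan s) by rewrite -cos_atanM; ring.
  by rewrite -cos_atan_sqr /fold_polar (mulrC r (cos _)); congr EFin; ring.
- move=> x; apply: cvgD; first exact: cs.
  apply: (@continuous_comp _ _ _ (fun x : R => - x) (fun x => shear (x, s))).
    exact: opp_continuous.
  exact: cs.
- by move=> x; rewrite addr_ge0.
Qed.

Let measurable_fold_polar : measurable_fun setT (fun z : mR * mR =>
  (1 + z.1 ^+ 2)^-1 * (z.2 * fold_polar g z.2 (atan z.1))).
Proof.
have mcomp (h : R -> R) : continuous h ->
    measurable_fun setT (fun z : mR * mR => h z.1).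
  move=> ch; apply: (measurableT_comp (f := h : mR -> mR)) => //.
  exact: continuous_measurable_fun.
have mc : measurable_fun setT (fun z : mR * mR => z.2 * cos (atan z.1)).
  apply: measurable_funM => //; apply: (mcomp (cos \o atan)) => x.
  apply: (@continuous_comp _ _ _ atan cos); first exact: continuous_atan.
  exact: continuous_cos.
have ms : measurable_fun setT (fun z : mR * mR => z.2 * sin (atan z.1)).
  apply: measurable_funM => //; apply: (mcomp (sin \o atan)) => x.
  apply: (@continuous_comp _ _ _ atan sin); first exact: continuous_atan.
  exact: continuous_sin.
apply: measurable_funM; first exact: (mcomp _ (@continuous_oneDsqrV R)).
apply: measurable_funM => //; apply: measurable_funD; first exact: meas_pair.
by apply: meas_pair => //; exact: measurableT_comp.
Qed.

(** Three substitutions in one variable, with Tonelli in between: [y = |x| s] for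
    fixed [x], then [x = r cos (atan s)] along the ray of slope [s], and at last
    [theta = atan s]. *)
Lemma polar_coordinates :
  (\int[mu \x mu]_z (g z)%:E = \int[mu]_(r in halfline)
     \int[mu]_(theta in `](- (pi / 2))%R, (pi / 2)%R[)
       (r * fold_polar g r theta)%:E)%E.
Proof.
rewrite fubini_tonelli1; last 2 first.
- exact/measurable_EFinP.
- by move=> z; rewrite lee_fin.
rewrite [LHS]integral_shear.
rewrite (fubini_tonelli (EFin \o shear)); last 2 first.
- exact/measurable_EFinP.
- by move=> z; rewrite lee_fin.
under eq_integral do rewrite integral_ray.
rewrite (fubini_tonelli_halfline measurable_fold_polar); last first.
  by move=> s r r0; rewrite !mulr_ge0 ?addr_ge0 ?invr_ge0 ?addr_ge0 ?sqr_ge0.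
apply: eq_integral => r; rewrite inE/= in_itv/= andbT => r0.
have -> : [set: mR] = \bigcup_k `[- k%:R, k%:R]%classic.
  apply/seteqP; split => // x _; exists (Num.trunc `|x|).+1 => //=.
  by rewrite in_itv/= -ler_norml ltW// truncnS_gt.
have -> : `](- (pi / 2)), (pi / 2)[%classic =
    \bigcup_k `[atan (- k%:R), atan k%:R]%classic :> set R.
  apply/seteqP; split => x/=; last first.
    move=> [k _] /=; rewrite !in_itv/= => /andP[kx xk].
    by rewrite (lt_le_trans (atan_gtNpi2 _) kx) (le_lt_trans xk (atan_ltpi2 _)).
  move=> xpi; exists (Num.trunc `|tan x|).+1 => //=.
  have := truncnS_gt `|tan x|; rewrite ltr_norml => /andP[/ltW tx1 /ltW tx2].
  have [y1 y2] : atan (- (Num.trunc `|tan x|).+1%:R) <= atan (tan x) /\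
      atan (tan x) <= atan (Num.trunc `|tan x|).+1%:R by rewrite !le_atan.
  by rewrite tanK in y1 y2 *; rewrite ?in_itv/= ?y1.
rewrite (@ge0_integral_substitution_bigcup R atan (fun x => (1 + x ^+ 2)^-1)
  (fun theta => r * fold_polar g r theta) (fun k => - k%:R) (fun k => k%:R)).
- by apply: eq_integral => s _; rewrite mulrC.
- exact: continuous_oneDsqrV.
- by move=> k l kl; rewrite lerN2 ler_nat.
- by move=> k l kl; rewrite ler_nat.
- by move=> k; rewrite (@le_trans _ _ 0)// oppr_le0.
- by move=> k x y _ _; exact: lt_atan.
- by move=> k x _; rewrite invr_ge0 addr_ge0 ?sqr_ge0.
- move=> k y _; split; last by rewrite mulr_ge0 ?addr_ge0.
  have cc : continuous (fun y => r * cos y).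
    by move=> z; apply: cvgM; [exact: cvg_cst|exact: continuous_cos].
  have csn : continuous (fun y => r * sin y).
    by move=> z; apply: cvgM; [exact: cvg_cst|exact: continuous_sin].
  apply: cvgM; first exact: cvg_cst.
  have cN : continuous (fun y => - (r * cos y)).
    by move=> z; apply: cvgN; exact: cc.
  rewrite /fold_polar; apply: cvgD; first exact: (cont_pair cc csn).
  exact: (cont_pair cN csn).
Qed.

End polar.

(** * Cosine expansions *)

Section cosine_powers.
Context {R : realType}.
Implicit Types v w c delta A B : R.

(** A factor [2 cos v] shifts the frequency by [1] and by [- 1], and Pascal's rule
    counts the ways. *)
Lemma cos_power_expansion v w n :
  (2 * cos v) ^+ n * cos w =
  \sum_(k < n.+1) 'C(n, k)%:R * cos ((2 * k%:R - n%:R) * v + w).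
Proof.
elim: n w => [|n ih] w.
  by rewrite big_ord_recl big_ord0 bin0 expr0 !mul1r mulr0 subr0 mul0r add0r addr0.
have -> : (2 * cos v) ^+ n.+1 * cos w =
    (2 * cos v) ^+ n * cos (w + v) + (2 * cos v) ^+ n * cos (w - v).
  rewrite exprSr cosD cosB; ring.
rewrite !ih [RHS]big_ord_recl bin0/=.
under [in RHS]eq_bigr => i _ do rewrite /bump/= add1n binS natrD mulrDl.
rewrite [in RHS]big_split/= addrA [RHS]addrC; congr (_ + _).
  apply: eq_bigr => i _; congr (_ * cos _).
  by rewrite -(natr1 n) -(natr1 i); ring.
rewrite big_ord_recl bin0/= [in RHS]big_ord_recr/= bin_small// mul0r addr0.
congr (_ + _); first by congr (_ * cos _); rewrite -(natr1 n); ring.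
apply: eq_bigr => i _; rewrite /bump/= add1n; congr (_ * cos _).
by rewrite -(natr1 n); ring.
Qed.

(** [exp (A cos v)] is the sum over [k] and [k'] of [exp_half A k * exp_half A k']
    times the exponential of [i (k - k') v]. *)
Definition exp_half A (k : nat) : R := (A / 2) ^+ k / k`!%:R.

Lemma exp_half_ge0 A k : 0 <= A -> 0 <= exp_half A k.
Proof. by move=> A0; rewrite divr_ge0// exprn_ge0// divr_ge0. Qed.

Lemma exp_term_cos A v w n :
  (A * cos v) ^+ n / n`!%:R * cos w =
  \sum_(k < n.+1) exp_half A k * exp_half A (n - k) *
    cos ((k%:R - (n - k)%:R) * v + w).
Proof.
transitivity ((A / 2) ^+ n / n`!%:R * ((2 * cos v) ^+ n * cos w)).
  have -> : A * cos v = (A / 2) * (2 * cos v) by field.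
  by rewrite exprMn; ring.
rewrite cos_power_expansion mulr_sumr.
apply: eq_bigr => k _.
have kn : (k <= n)%N by rewrite -ltnS.
move: (nat_of_ord k) kn => {}k kn.
rewrite -(bin_fact kn) !natrM /exp_half natrB//.
have -> : (A / 2) ^+ n = (A / 2) ^+ k * (A / 2) ^+ (n - k).
  by rewrite -exprD subnKC.
have -> : 2 * k%:R - n%:R = k%:R - (n%:R - k%:R) :> R by ring.
have f0 i : i`!%:R != 0 :> R by rewrite pnatr_eq0 -lt0n fact_gt0.
have b0 : 'C(n, k)%:R != 0 :> R by rewrite pnatr_eq0 -lt0n bin_gt0.
by field; rewrite !f0 b0.
Qed.

(** The weight in [exp (A cos v + B cos u)] of the mode with frequency [q - q'] in
    [v] and [p - p'] in [u]. *)
Definition quad_weight A B (q q' p p' : nat) : R :=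
  exp_half A q * exp_half A q' * (exp_half B p * exp_half B p').

Lemma exp_term_cosD A B v u N :
  (A * cos v + B * cos u) ^+ N / N`!%:R =
  \sum_(i < N.+1) \sum_(q < i.+1) \sum_(p < (N - i).+1)
    quad_weight A B q (i - q) p (N - i - p) *
    cos ((q%:R - (i - q)%:R) * v + (p%:R - (N - i - p)%:R) * u).
Proof.
rewrite addrC exprDn mulr_suml; apply: eq_bigr => i _.
have iN : (i <= N)%N by rewrite -ltnS.
move: (nat_of_ord i) iN => {}i iN.
transitivity ((B * cos u) ^+ (N - i) / (N - i)`!%:R *
    ((A * cos v) ^+ i / i`!%:R * cos 0)).
  have f0 k : k`!%:R != 0 :> R by rewrite pnatr_eq0 -lt0n fact_gt0.
  have b0 : 'C(N, i)%:R != 0 :> R by rewrite pnatr_eq0 -lt0n bin_gt0.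
  rewrite -mulr_natr -(bin_fact iN) !natrM cos0.
  by field; rewrite !f0 b0.
rewrite exp_term_cos mulr_sumr; apply: eq_bigr => q _.
rewrite mulrCA exp_term_cos mulr_sumr; apply: eq_bigr => p _.
by rewrite /quad_weight addr0 -[RHS]mulrA; congr (_ * (_ * cos _)); rewrite addrC.
Qed.

Lemma sinDnat2pi (x : R) n : sin (x + n%:R * (2 * pi)) = sin x.
Proof.
have -> : n%:R * (2 * pi) = pi *+ 2 *+ n :> R by rewrite mulr_natl mulr_natl.
exact/periodicn/sinD2pi.
Qed.

Notation mu := (@lebesgue_measure R).
Notation halfturn := (`](- (pi / 2))%R, (pi / 2)%R[%classic : set (measurableTypeR R)).

(** [x] and [pi - x] together run through a full turn, on which distinct
    frequencies are orthogonal. *)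
Lemma integral_cos_fold (m n : nat) c :
  \int[mu]_(x in halfturn)
    (cos ((m%:R - n%:R) * x + c) + cos ((m%:R - n%:R) * (pi - x) + c)) =
  if m == n then 2 * pi * cos c else 0.
Proof.
case: eqVneq => [->|mn].
  under eq_Rintegral do rewrite subrr !mul0r !add0r.
  rewrite Rintegral_cst//= lebesgue_measure_itv/= lte_fin.
  rewrite ifT; last by rewrite (@lt_trans _ _ 0)// ?oppr_lt0 divr_gt0// pi_gt0.
  by rewrite /=; field.
set k : R := m%:R - n%:R.
have k0 : k != 0 by rewrite subr_eq0 eqr_nat.
pose F x := (sin (k * x + c) - sin (k * (pi - x) + c)) / k.
have dF (x : R) : is_derive x 1 F (cos (k * x + c) + cos (k * (pi - x) + c)).
  apply: trigger_derive; rewrite /GRing.scale/=.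
  by field.
have cF : continuous F.
  by move=> x; apply: differentiable_continuous; apply/derivable1_diffP.
have pm : - (pi / 2) < pi / 2 :> R.
  by rewrite (@lt_trans _ _ 0)// ?oppr_lt0 divr_gt0// pi_gt0.
have cf : continuous (fun x : R => cos (k * x + c) + cos (k * (pi - x) + c)).
  by move=> x; apply: differentiable_continuous; apply/derivable1_diffP.
rewrite /Rintegral -(@integral_itv_bndoo _ _ _ _ true false); last first.
  apply/measurable_EFinP/measurable_funTS; exact: continuous_measurable_fun.
rewrite (@continuous_FTC2 _ _ F)//.
- rewrite -EFinB /= /F.
  have -> : pi - pi / 2 = pi / 2 :> R by field.
  rewrite subrr mul0r sub0r.
  have -> : k * (pi - - (pi / 2)) + c =
      k * - (pi / 2) + c - n%:R * (2 * pi) + m%:R * (2 * pi).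
    by rewrite /k; field.
  rewrite sinDnat2pi -(sinDnat2pi (_ - n%:R * (2 * pi)) n) subrK.
  by rewrite subrr mul0r oppr0.
- exact: continuous_subspaceT.
- split => //.
  + exact/cvg_at_right_filter/cF.
  + exact/cvg_at_left_filter/cF.
- by move=> x _; rewrite derive1E derive_val.
Qed.

End cosine_powers.

(** * The angular integral *)

Section Rintegral_sum.
Context d (T : measurableType d) {R : realType}.
Variables (mu : {measure set T -> \bar R}) (D : set T).
Hypothesis mD : measurable D.

Lemma integrable_sumR I (s : seq I) (F : I -> T -> R) :
  (forall i, mu.-integrable D (EFin \o F i)) ->
  mu.-integrable D (EFin \o (fun x => \sum_(i <- s) F i x)).
Proof.
move=> iF; rewrite (_ : _ \o _ = fun x => (\sum_(i <- s) (EFin \o F i) x)%E).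
  exact: integrable_sum.
by apply/funext => x /=; rewrite sumEFin.
Qed.

Lemma Rintegral_sum I (s : seq I) (F : I -> T -> R) :
  (forall i, mu.-integrable D (EFin \o F i)) ->
  \int[mu]_(x in D) \sum_(i <- s) F i x = \sum_(i <- s) \int[mu]_(x in D) F i x.
Proof.
move=> iF; rewrite /Rintegral sum_fine; last first.
  by move=> i _; apply: integrable_fin_num => //; exact: iF.
rewrite -integral_sum//; congr fine; apply: eq_integral => x _.
by rewrite sumEFin.
Qed.

End Rintegral_sum.

Section angular_integral.
Context {R : realType}.
Notation mu := (@lebesgue_measure R).
Notation halfturn := (`](- (pi / 2))%R, (pi / 2)%R[%classic : set (measurableTypeR R)).
Variables (A B c : R).

Lemma integrable_halfturn (f : R -> R) : continuous f ->
  mu.-integrable halfturn (EFin \o f).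
Proof.
move=> cf.
have sub : halfturn `<=` `[(- (pi / 2))%R, (pi / 2)%R]%classic.
  exact: subset_itv_oo_cc.
apply: (integrableS _ _ sub) => //.
apply: continuous_compact_integrable; first exact: segment_compact.
exact: continuous_subspaceT.
Qed.

Definition phase (delta u : R) : R := A * cos (2 * u - 2 * delta) + B * cos u.

Definition angular delta : R := \int[mu]_(x in halfturn)
  (expR (phase delta (x + c)) + expR (phase delta (pi - x + c))).

Let continuous_phase delta (h : R -> R) : continuous h ->
  continuous (fun x => phase delta (h x)).
Proof.
move=> ch x; have cc : continuous (phase delta).
  by move=> y; apply: differentiable_continuous; apply/derivable1_diffP.
by apply: (@continuous_comp _ _ _ h (phase delta)); [exact: ch|exact: cc].
Qed.

Let cadd : continuous (fun x : R => x + c).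
Proof. by move=> x; apply: cvgD; [exact: cvg_id|exact: cvg_cst]. Qed.

Let cref : continuous (fun x : R => pi - x + c).
Proof.
move=> x; apply: cvgD; last exact: cvg_cst.
by apply: cvgB; [exact: cvg_cst|exact: cvg_id].
Qed.

Let integrable_expR_phase delta (h : R -> R) : continuous h ->
  mu.-integrable halfturn (EFin \o (fun x => expR (phase delta (h x)))).
Proof.
move=> ch; apply: integrable_halfturn => x.
apply: (@continuous_comp _ _ _ (fun x => phase delta (h x)) expR).
  exact: continuous_phase.
exact: continuous_expR.
Qed.

Lemma integrable_angular delta : mu.-integrable halfturn (EFin \o (fun x =>
  expR (phase delta (x + c)) + expR (phase delta (pi - x + c)))).
Proof.
have := integrableD _ (integrable_expR_phase delta cadd)
  (integrable_expR_phase delta cref).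
exact.
Qed.

Let cvg_expR_phase delta (h : R -> R) : continuous h ->
  series (fun N => \int[mu]_(x in halfturn) (phase delta (h x) ^+ N / N`!%:R)) @ \oo
    --> \int[mu]_(x in halfturn) expR (phase delta (h x)).
Proof.
move=> ch; have cp : continuous (fun x => phase delta (h x)).
  exact: continuous_phase.
have -> : (fun N => \int[mu]_(x in halfturn) (phase delta (h x) ^+ N / N`!%:R)) =
    (fun N => \int[mu]_(x in halfturn)
      (cst 1 x * (phase delta (h x) ^+ N / N`!%:R))).
  by apply/funext => N; apply: eq_Rintegral => x _; rewrite mul1r.
have -> : \int[mu]_(x in halfturn) expR (phase delta (h x)) =
    \int[mu]_(x in halfturn) (cst 1 x * expR (phase delta (h x))).
  by apply: eq_Rintegral => x _; rewrite mul1r.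
apply: cvg_expR_series_integral => //.
- by apply: measurable_funTS; exact: continuous_measurable_fun.
- rewrite (_ : (fun x => _) = EFin \o (fun x => expR `|phase delta (h x)|)).
    apply: integrable_halfturn => x.
    apply: (@continuous_comp _ _ _ (fun x => `|phase delta (h x)|) expR).
      by apply: cvg_norm; exact: cp.
    exact: continuous_expR.
  by apply/funext => x; rewrite mul1r.
Qed.

(** The integral over a full turn of the mode [(q, q', p, p')], whose frequency
    is [2 (q - q') + (p - p')]. *)
Definition resonance delta (q q' p p' : nat) : R :=
  quad_weight A B q q' p p' *
  (if (p + 2 * q == p' + 2 * q')%N then 2 * pi * cos (2 * (q%:R - q'%:R) * delta)
   else 0).

Let integrable_mode (m n : nat) (w d : R) : mu.-integrable halfturn
  (EFin \o (fun x => w * (cos ((m%:R - n%:R) * x + d) +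
                          cos ((m%:R - n%:R) * (pi - x) + d)))).
Proof.
apply: integrable_halfturn => x.
by apply: differentiable_continuous; apply/derivable1_diffP.
Qed.

Let integral_phase_term delta N :
  \int[mu]_(x in halfturn) (phase delta (x + c) ^+ N / N`!%:R +
                            phase delta (pi - x + c) ^+ N / N`!%:R) =
  \sum_(i < N.+1) \sum_(q < i.+1) \sum_(p < (N - i).+1)
    resonance delta q (i - q) p (N - i - p).
Proof.
have cast2 m n : (m + 2 * n)%:R = m%:R + 2 * n%:R :> R by rewrite natrD natrM.
pose d (q q' p p' : nat) : R := ((p + 2 * q)%:R - (p' + 2 * q')%:R) * c
  - 2 * (q%:R - q'%:R) * delta.
pose F q q' p p' (x : R) := quad_weight A B q q' p p' *
  (cos (((p + 2 * q)%:R - (p' + 2 * q')%:R) * x + d q q' p p') +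
   cos (((p + 2 * q)%:R - (p' + 2 * q')%:R) * (pi - x) + d q q' p p')).
transitivity (\int[mu]_(x in halfturn) \sum_(i < N.+1) \sum_(q < i.+1)
    \sum_(p < (N - i).+1) F q (i - q)%N p (N - i - p)%N x).
  apply: eq_Rintegral => x _; rewrite /phase !exp_term_cosD -big_split/=.
  apply: eq_bigr => i _; rewrite -big_split/=.
  apply: eq_bigr => q _; rewrite -big_split/=.
  apply: eq_bigr => p _; rewrite -mulrDr /F /d; congr (_ * (cos _ + cos _)).
    by rewrite !cast2; ring.
  by rewrite !cast2; ring.
have iF q q' p p' : mu.-integrable halfturn (EFin \o F q q' p p').
  exact: integrable_mode.
rewrite Rintegral_sum//; last first.
  by move=> i; apply: integrable_sumR => // q; exact: integrable_sumR.
apply: eq_bigr => i _; rewrite Rintegral_sum//; last first.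
  by move=> q; exact: integrable_sumR.
apply: eq_bigr => q _; rewrite Rintegral_sum//; apply: eq_bigr => p _.
rewrite /F RintegralZl//; last first.
  apply: eq_integrable (integrable_mode (p + 2 * q) (N - i - p + 2 * (i - q)) 1
    (d q (i - q) p (N - i - p))%N) => // x _.
  by rewrite /= mul1r.
rewrite integral_cos_fold /resonance; congr (_ * _).
case: eqP => // e; congr (_ * _).
by rewrite /d e subrr mul0r add0r cosN.
Qed.

(** The terms are grouped by total degree [N], the order in which the exponential
    series converges. *)
Lemma cvg_angular delta :
  series (fun N => \sum_(i < N.+1) \sum_(q < i.+1) \sum_(p < (N - i).+1)
    resonance delta q (i - q) p (N - i - p)) @ \oo --> angular delta.
Proof.
have ipN (h : R -> R) N : continuous h ->
    mu.-integrable halfturn (EFin \o (fun x => phase delta (h x) ^+ N / N`!%:R)).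
  move=> ch; apply: integrable_halfturn => x; apply: cvgM; last exact: cvg_cst.
  apply: (@continuous_comp _ _ _ (fun x => phase delta (h x)) (fun y => y ^+ N)).
    exact: continuous_phase.
  exact: exprn_continuous.
rewrite /angular RintegralD//; [|exact: integrable_expR_phase..].
rewrite (_ : (fun N => _) =
  (fun N => \int[mu]_(x in halfturn) (phase delta (x + c) ^+ N / N`!%:R)) +
  (fun N => \int[mu]_(x in halfturn) (phase delta (pi - x + c) ^+ N / N`!%:R))).
  rewrite seriesD; apply: cvgD; exact: cvg_expR_phase.
apply/funext => N; rewrite -integral_phase_term RintegralD//; exact: ipN.
Qed.

Lemma angular_le delta : 0 <= A -> 0 <= B ->
  angular delta <= 2 * pi * expR (A + B).
Proof.
move=> A0 B0.
have phase_le d u : phase d u <= A + B.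
  by rewrite lerD// ler_piMr// cos_le1.
have -> : 2 * pi * expR (A + B) =
    \int[mu]_(x in halfturn) cst (expR (A + B) + expR (A + B)) x.
  rewrite Rintegral_cst//= lebesgue_measure_itv/= lte_fin.
  rewrite ifT; last by rewrite (@lt_trans _ _ 0)// ?oppr_lt0 divr_gt0// pi_gt0.
  by rewrite /=; field.
apply: le_Rintegral => //.
- exact: integrable_angular.
- by apply: integrable_halfturn => x; exact: cvg_cst.
- by move=> x _; rewrite lerD// ler_expR.
Qed.

Lemma angular_ge0 delta : 0 <= angular delta.
Proof. by apply: Rintegral_ge0 => x _; rewrite addr_ge0 ?expR_ge0. Qed.

End angular_integral.

(** * Rearranging the angular series *)

Section fourfold_sums.
Context {R : realType}.
Local Open Scope ereal_scope.
Variable f : nat -> nat -> nat -> nat -> \bar R.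
Hypothesis f0 : forall q q' p p', 0 <= f q q' p p'.

Lemma nneseries_diag4 :
  \sum_(N <oo) \sum_(i < N.+1) \sum_(q < i.+1) \sum_(p < (N - i).+1)
    f q (i - q)%N p (N - i - p)%N =
  \sum_(q <oo) \sum_(q' <oo) \sum_(p <oo) \sum_(p' <oo) f q q' p p'.
Proof.
rewrite (@nneseries_diag _ (fun i j => \sum_(q < i.+1) \sum_(p < j.+1)
    f q (i - q)%N p (j - p)%N)); last first.
  by move=> i j; apply: sume_ge0 => q _; exact: sume_ge0.
rewrite -(@nneseries_diag _ (fun q q' => \sum_(p <oo) \sum_(p' <oo) f q q' p p'));
  last first.
  by move=> q q'; apply: nneseries_ge0 => p _ _; exact: nneseries_ge0.
apply: eq_eseriesr => i _; rewrite nneseries_sum; last first.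
  by move=> q j _; exact: sume_ge0.
by apply: eq_bigr => q _; rewrite (@nneseries_diag _ (f q (i - q)%N)).
Qed.

Hypothesis f_resonant : forall q q' p p',
  (p + 2 * q != p' + 2 * q')%N -> f q q' p p' = 0.
Hypothesis f_sym : forall q q' p p', f q q' p p' = f q' q p' p.

(** For given [q], [q'] and one of [p], [p'], resonance fixes the other; [j] is
    the distance of [q] and [q'], and [f_sym] identifies its two signs. *)
Lemma nneseries_resonant :
  \sum_(q <oo) \sum_(q' <oo) \sum_(p <oo) \sum_(p' <oo) f q q' p p' =
  \sum_(j <oo) \sum_(k2 <oo) (eps_coef R j)%:E *
    \sum_(k1 <oo) f (k2 + j)%N k2 k1 (k1 + 2 * j)%N.
Proof.
have pick j k p : \sum_(p' <oo) f (k + j)%N k p p' = f (k + j)%N k p (p + 2 * j)%N.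
  rewrite -(@nneseries_pick _ (f (k + j)%N k p) (p + 2 * j)%N)//.
  rewrite [RHS]eseries_mkcond; apply: eq_eseriesr => p' _; case: eqP => // ne.
  apply: f_resonant; apply/eqP => e; apply: ne; apply/eqP.
  by rewrite -(eqn_add2r (2 * k)) -e mulnDr addnAC addnA.
rewrite (@nneseries_dist _ (fun q q' => \sum_(p <oo) \sum_(p' <oo) f q q' p p'));
  last first.
  by move=> q q'; apply: nneseries_ge0 => p _ _; exact: nneseries_ge0.
apply: eq_eseriesr => j _; apply: eq_eseriesr => k _.
have E : \sum_(p <oo) \sum_(p' <oo) f (k + j)%N k p p' =
    \sum_(p <oo) f (k + j)%N k p (p + 2 * j)%N by apply: eq_eseriesr => p _.
have E' : \sum_(p <oo) \sum_(p' <oo) f k (k + j)%N p p' =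
    \sum_(p <oo) f (k + j)%N k p (p + 2 * j)%N.
  rewrite nneseries_interchange// -E; apply: eq_eseriesr => p _.
  by apply: eq_eseriesr => p' _; rewrite f_sym.
rewrite /eps_coef; case: eqVneq => [j0|_].
  by rewrite mul1e -E j0 addn0.
by rewrite E E' mule_natl mule2n.
Qed.

End fourfold_sums.

Section angular_series.
Context {R : realType}.
Variables (A B c : R).
Hypotheses (A0 : 0 <= A) (B0 : 0 <= B).

Lemma quad_weight_ge0 q q' p p' : 0 <= quad_weight A B q q' p p'.
Proof. by apply: mulr_ge0; apply: mulr_ge0; exact: exp_half_ge0. Qed.

Let res2 (delta : R) q q' p p' : R :=
  resonance A B delta q q' p p' + resonance A B 0 q q' p p'.

Let res2E delta q q' p p' : res2 delta q q' p p' =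
  quad_weight A B q q' p p' * (if (p + 2 * q == p' + 2 * q')%N then
    2 * pi * (1 + cos (2 * (q%:R - q'%:R) * delta)) else 0).
Proof.
rewrite /res2 /resonance; case: eqP => _; last by rewrite !mulr0 addr0.
by rewrite mulr0 cos0; ring.
Qed.

Let res2_ge0 delta q q' p p' : 0 <= res2 delta q q' p p'.
Proof.
rewrite res2E; apply: mulr_ge0; first exact: quad_weight_ge0.
case: eqP => // _; apply: mulr_ge0; first by rewrite mulr_ge0 ?pi_ge0.
by rewrite -lerBlDl sub0r cos_geN1.
Qed.

(** Adding the integral for [delta = 0] makes every term nonnegative, so that
    the absolutely convergent fourfold sum can be rearranged freely. *)
Lemma angularD_series delta :
  (angular A B c delta + angular A B c 0)%:E =
  (\sum_(j <oo) \sum_(k1 <oo) \sum_(k2 <oo)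
    (2 * pi * eps_coef R j * (1 + cos (2 * j%:R * delta)) *
     quad_weight A B (k2 + j) k2 k1 (k1 + 2 * j))%:E)%E.
Proof.
pose u N := \sum_(i < N.+1) \sum_(q < i.+1) \sum_(p < (N - i).+1)
  res2 delta q (i - q) p (N - i - p).
have u0 N : 0 <= u N.
  by apply: sumr_ge0 => i _; apply: sumr_ge0 => q _; exact: sumr_ge0.
have cu : series u @ \oo --> angular A B c delta + angular A B c 0.
  pose v d N := \sum_(i < N.+1) \sum_(q < i.+1) \sum_(p < (N - i).+1)
    resonance A B d q (i - q) p (N - i - p).
  rewrite (_ : u = v delta + v 0).
    by rewrite seriesD; apply: cvgD; exact: cvg_angular.
  apply/funext => N; rewrite /u -[RHS]big_split/=; apply: eq_bigr => i _.
  by rewrite -big_split/=; apply: eq_bigr => q _; rewrite -big_split.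
have /(nnseries_cvgP _ u0) <- := cu.
transitivity (\sum_(N <oo) \sum_(i < N.+1) \sum_(q < i.+1) \sum_(p < (N - i).+1)
    (res2 delta q (i - q) p (N - i - p))%:E)%E.
  apply: eq_eseriesr => N _; rewrite -sumEFin; apply: eq_bigr => i _.
  by rewrite -sumEFin; apply: eq_bigr => q _; rewrite -sumEFin.
have res2E0 q q' p p' : (0 <= (res2 delta q q' p p')%:E)%E by rewrite lee_fin.
rewrite (nneseries_diag4 res2E0) nneseries_resonant//; last 2 first.
- by move=> q q' p p' ne; rewrite res2E (negbTE ne) mulr0.
- move=> q q' p p'; congr EFin; rewrite !res2E eq_sym /quad_weight.
  rewrite (mulrC (exp_half A q)) (mulrC (exp_half B p)) -(cosN (_ * delta)).
  have -> : - (2 * (q%:R - q'%:R) * delta) = 2 * (q'%:R - q%:R) * delta by ring.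
  by [].
apply: eq_eseriesr => j _.
rewrite [RHS]nneseries_interchange; last first.
  move=> k1 k2; rewrite lee_fin; apply: mulr_ge0; last exact: quad_weight_ge0.
  apply: mulr_ge0; last by rewrite -lerBlDl sub0r cos_geN1.
  by rewrite !mulr_ge0 ?pi_ge0// /eps_coef; case: ifP.
apply: eq_eseriesr => k2 _; rewrite -nneseriesZl//.
apply: eq_eseriesr => k1 _; rewrite -EFinM; congr EFin.
rewrite res2E ifT; last by rewrite mulnDr addnA addnAC.
have -> : 2 * ((k2 + j)%:R - k2%:R) = 2 * j%:R :> R by rewrite natrD addrAC subrr add0r.
by ring.
Qed.

End angular_series.

(** * Integration over the radius *)

Section nonnegative_double_series.
Context {R : realType}.

Lemma nnseries_rsum (u : nat -> R) : (forall n, 0 <= u n) ->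
  (\sum_(n <oo) (u n)%:E < +oo)%E ->
  cvgn (series u) /\ (\sum_(n <oo) (u n)%:E = (rsum u)%:E)%E.
Proof.
move=> u0 uoo; have cu := nnseries_is_cvg u0 uoo; split => //.
exact/(nnseries_cvgP _ u0).
Qed.

Lemma rsum_ge0 (u : nat -> R) : (forall n, 0 <= u n) ->
  cvgn (series u) -> 0 <= rsum u.
Proof.
move=> u0 cu; apply: limr_ge => //; apply: nearW => n.
by apply: sumr_ge0.
Qed.

Lemma nnseries_rsum2 (u : nat -> nat -> R) : (forall m n, 0 <= u m n) ->
  (\sum_(m <oo) \sum_(n <oo) (u m n)%:E < +oo)%E ->
  [/\ (forall m, cvgn (series (u m))),
      cvgn (series (fun m => rsum (u m))) &
      (\sum_(m <oo) \sum_(n <oo) (u m n)%:E =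
       (rsum (fun m => rsum (u m)))%:E)%E].
Proof.
move=> u0 uoo.
have un m : cvgn (series (u m)) /\ (\sum_(n <oo) (u m n)%:E = (rsum (u m))%:E)%E.
  apply: nnseries_rsum => //; rewrite ltey; apply: contraTN uoo => /eqP moo.
  rewrite -leNgt leye_eq; apply/eqP.
  apply: (@nneseries_pinfty _ _ xpredT m) => //= k _.
  by apply: nneseries_ge0 => n _ _; rewrite lee_fin.
have E : (\sum_(m <oo) \sum_(n <oo) (u m n)%:E = \sum_(m <oo) (rsum (u m))%:E)%E.
  by apply: eq_eseriesr => m _; exact: (un m).2.
rewrite E in uoo *.
have [] := nnseries_rsum _ uoo.
  by move=> m; apply: rsum_ge0 => //; exact: (un m).1.
by move=> c1 ->; split => // m; exact: (un m).1.
Qed.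

End nonnegative_double_series.

Section radial_series.
Context {R : realType}.
Notation mu := (@lebesgue_measure R).
Notation halfline := (`[0%R, +oo[%classic : set (measurableTypeR R)).
Variables (b t e p c : R).
Hypotheses (e0 : 0 <= e) (eb : e < b) (p0 : 0 <= p).

Let b0 : 0 < b. Proof. exact: le_lt_trans eb. Qed.

(** The integrand in the radius once the angle has been integrated out; the
    exponent [1] is the Jacobian of polar coordinates. *)
Definition polar_kernel delta r : R :=
  radial_weight b t 1 r * angular (e * r ^+ 2) (p * r) c delta.

Let coef j k1 k2 : R := (e * p ^+ 2 / 8) ^+ j * coef_term k1 k2 j p e.

Let coef_term_ge0 k1 k2 j : 0 <= coef_term k1 k2 j p e.
Proof. by rewrite /coef_term divr_ge0 ?mulr_ge0 ?exprn_ge0. Qed.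

Let coef_ge0 j k1 k2 : 0 <= coef j k1 k2.
Proof. by rewrite mulr_ge0 ?exprn_ge0 ?divr_ge0 ?mulr_ge0 ?exprn_ge0. Qed.

Let quad_weightE j k1 k2 r :
  radial_weight b t 1 r *
    quad_weight (e * r ^+ 2) (p * r) (k2 + j) k2 k1 (k1 + 2 * j) =
  coef j k1 k2 * radial_weight b t (2 * ell k1 k2 j + 1) r.
Proof.
have f0 i : i`!%:R != 0 :> R by rewrite pnatr_eq0 -lt0n fact_gt0.
rewrite /coef /coef_term /quad_weight /exp_half /radial_weight.
have -> : r ^+ (2 * ell k1 k2 j + 1) = r * (r ^+ k1) ^+ 2 * (r ^+ k2) ^+ 4 * (r ^+ j) ^+ 4.
  rewrite -!exprM -{2}(expr1 r) -!exprD; congr (_ ^+ _).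
  by rewrite /ell; lia.
have X2 (x : R) k : x ^+ (2 * k) = (x ^+ k) ^+ 2 by rewrite mulnC exprM.
have XA k : (e * r ^+ 2 / 2) ^+ k = e ^+ k * (r ^+ k) ^+ 2 / 2 ^+ k.
  by rewrite expr_div_n exprMn -X2 exprM.
have XB k : (p * r / 2) ^+ k = p ^+ k * r ^+ k / 2 ^+ k.
  by rewrite expr_div_n exprMn.
have -> : (e * p ^+ 2 / 8) ^+ j = e ^+ j * (p ^+ j) ^+ 2 / (2 ^+ j) ^+ 3.
  rewrite expr_div_n exprMn -X2 exprM; congr (_ / _).
  by rewrite -exprM mulnC exprM (_ : 2 ^+ 3 = 8) // -natrX.
have -> : 4 ^+ (k1 + k2) = (2 ^+ k1) ^+ 2 * (2 ^+ k2) ^+ 2 :> R.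
  by rewrite exprD -!X2 !exprM (_ : 2 ^+ 2 = 4) // -natrX.
rewrite !XA !XB !X2 !exprD expr1.
have h0 i : 2 ^+ i != 0 :> R by rewrite expf_neq0.
by field; rewrite !f0 !h0.
Qed.

Let modulus delta j : R := 2 * pi * eps_coef R j * (1 + cos (2 * j%:R * delta)).

Let modulus_ge0 delta j : 0 <= modulus delta j.
Proof.
apply: mulr_ge0; last by rewrite -lerBlDl sub0r cos_geN1.
by rewrite !mulr_ge0 ?pi_ge0// /eps_coef; case: ifP.
Qed.

Let kernel_term delta j k1 k2 r : R :=
  modulus delta j * coef j k1 k2 * radial_weight b t (2 * ell k1 k2 j + 1) r.

Let kernel_term_ge0 delta j k1 k2 r : halfline r ->
  (0 <= (kernel_term delta j k1 k2 r)%:E)%E.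
Proof.
rewrite /= in_itv/= andbT => r0; rewrite lee_fin; apply: mulr_ge0.
  exact: mulr_ge0.
exact: radial_weight_ge0.
Qed.

Let polar_kernelD delta r : halfline r ->
  (polar_kernel delta r + polar_kernel 0 r)%:E =
  (\sum_(j <oo) \sum_(k1 <oo) \sum_(k2 <oo) (kernel_term delta j k1 k2 r)%:E)%E.
Proof.
rewrite /= in_itv/= andbT => r0.
have A0 : 0 <= e * r ^+ 2 by rewrite mulr_ge0// sqr_ge0.
have B0 : 0 <= p * r by rewrite mulr_ge0.
rewrite /polar_kernel -mulrDr EFinM (angularD_series c A0 B0).
have w0 : 0 <= radial_weight b t 1 r by exact: radial_weight_ge0.
have t0 j k1 k2 : (0 <= (2 * pi * eps_coef R j * (1 + cos (2 * j%:R * delta)) *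
     quad_weight (e * r ^+ 2) (p * r) (k2 + j) k2 k1 (k1 + 2 * j))%:E)%E.
  by rewrite lee_fin mulr_ge0 ?modulus_ge0 ?quad_weight_ge0.
rewrite -nneseriesZl; last first.
  by move=> j _; apply: nneseries_ge0 => k1 _ _; exact: nneseries_ge0.
apply: eq_eseriesr => j _; rewrite -nneseriesZl; last first.
  by move=> k1 _; exact: nneseries_ge0.
apply: eq_eseriesr => k1 _; rewrite -nneseriesZl//.
apply: eq_eseriesr => k2 _; rewrite -EFinM; congr EFin.
by rewrite /kernel_term -[RHS]mulrA -quad_weightE /modulus; ring.
Qed.

Let measurable_kernel_term delta j k1 k2 :
  measurable_fun halfline (fun r => (kernel_term delta j k1 k2 r)%:E).
Proof.
apply/measurable_EFinP; apply: measurable_funM => //.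
by apply: measurable_funTS; exact: measurable_radial_weight.
Qed.

Let measurable_polar_kernelD delta :
  measurable_fun halfline (fun r => polar_kernel delta r + polar_kernel 0 r).
Proof.
apply/measurable_EFinP.
apply: (eq_measurable_fun (fun r => \sum_(j <oo) \sum_(k1 <oo) \sum_(k2 <oo)
    (kernel_term delta j k1 k2 r)%:E)%E).
  by move=> r; rewrite inE => Hr; rewrite -polar_kernelD.
apply: ge0_emeasurable_sum => [j r Hr _|j _].
  by apply: nneseries_ge0 => k1 _ _; apply: nneseries_ge0 => k2 _ _; exact: kernel_term_ge0.
apply: ge0_emeasurable_sum => [k1 r Hr _|k1 _].
  by apply: nneseries_ge0 => k2 _ _; exact: kernel_term_ge0.
apply: ge0_emeasurable_sum => [k2 r Hr _|k2 _]; first exact: kernel_term_ge0.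
exact: measurable_kernel_term.
Qed.

(** The sums of two kernels are series of measurable functions, and single kernels
    are linear combinations of such sums. *)
Lemma measurable_polar_kernel delta : measurable_fun halfline (polar_kernel delta).
Proof.
have m0 : measurable_fun halfline (polar_kernel 0).
  apply: (eq_measurable_fun (fun r => 2^-1 * (polar_kernel 0 r + polar_kernel 0 r))).
    by move=> r _; field.
  by apply: measurable_funM => //; exact: measurable_polar_kernelD.
apply: (eq_measurable_fun (fun r =>
    (polar_kernel delta r + polar_kernel 0 r) - polar_kernel 0 r)).
  by move=> r _; rewrite addrK.
by apply: measurable_funB => //; exact: measurable_polar_kernelD.
Qed.

Lemma polar_kernel_ge0 delta r : 0 <= r -> 0 <= polar_kernel delta r.
Proof.
by move=> r0; apply: mulr_ge0; [exact: radial_weight_ge0|exact: angular_ge0].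
Qed.

(** The phase is at most [e r^2 + p r], and [e < b] leaves Gaussian decay. *)
Lemma integrable_polar_kernel delta :
  mu.-integrable halfline (EFin \o polar_kernel delta).
Proof.
have be : 0 < b - e by rewrite subr_gt0.
apply: (@le_integrable _ _ _ mu halfline _ _
  (fun x => (2 * pi)%:E * (radial_weight (b - e) (t + p) 1 x)%:E)%E).
- by [].
- by apply/measurable_EFinP; exact: measurable_polar_kernel.
- move=> r; rewrite /= in_itv/= andbT => r0.
  rewrite lee_fin !ger0_norm ?polar_kernel_ge0//; last first.
    by rewrite mulr_ge0 ?radial_weight_ge0// mulr_ge0// pi_ge0.
  rewrite /polar_kernel.
  apply: (@le_trans _ _ (radial_weight b t 1 r *
      (2 * pi * expR (e * r ^+ 2 + p * r)))).
    rewrite ler_wpM2l ?radial_weight_ge0// angular_le//.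
      by rewrite mulr_ge0 ?sqr_ge0.
    exact: mulr_ge0.
  rewrite /radial_weight mulrCA ler_wpM2l ?mulr_ge0 ?pi_ge0//.
  rewrite -mulrA -expRD ler_wpM2l// ler_expR.
  have -> : t * r - b * r ^+ 2 + (e * r ^+ 2 + p * r) =
    (t + p) * r - (b - e) * r ^+ 2 by ring.
  exact: lexx.
- by apply: (integrableZl _ _ (integrable_radial_weight _ _ be)).
Qed.

Definition inner_term j k1 k2 : R :=
  coef_term k1 k2 j p e * calI b (2 * ell k1 k2 j + 1) t.

Lemma inner_term_ge0 j k1 k2 : 0 <= inner_term j k1 k2.
Proof. by apply: mulr_ge0 => //; exact: calI_ge0. Qed.

Definition inner_esum j : \bar R :=
  (\sum_(k1 <oo) \sum_(k2 <oo) (inner_term j k1 k2)%:E)%E.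

Lemma inner_esum_ge0 j : (0 <= inner_esum j)%E.
Proof.
apply: nneseries_ge0 => k1 _ _; apply: nneseries_ge0 => k2 _ _.
by rewrite lee_fin inner_term_ge0.
Qed.

(** Tonelli for the nonnegative terms of [angularD_series]; each of them is a power
    of [r] times the radial weight, and integrates to [calI]. *)
Lemma integral_polar_kernelD delta :
  (\int[mu]_(r in halfline) polar_kernel delta r +
   \int[mu]_(r in halfline) polar_kernel 0 r)%:E =
  (\sum_(j <oo) (2 * pi * eps_coef R j * (1 + cos (2 * j%:R * delta)) *
    (e * p ^+ 2 / 8) ^+ j)%:E * inner_esum j)%E.
Proof.
rewrite -RintegralD//; [|exact: integrable_polar_kernel..].
rewrite /Rintegral fineK; last first.
  apply: integrable_fin_num => //.
  have := integrableD _ (integrable_polar_kernel delta) (integrable_polar_kernel 0).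
  exact.
transitivity (\int[mu]_(r in halfline) \sum_(j <oo) \sum_(k1 <oo) \sum_(k2 <oo)
    (kernel_term delta j k1 k2 r)%:E)%E.
  by apply: eq_integral => r; rewrite inE => Hr; rewrite -polar_kernelD.
have m1 j k1 : measurable_fun halfline (fun r =>
    \sum_(k2 <oo) (kernel_term delta j k1 k2 r)%:E)%E.
  apply: ge0_emeasurable_sum => [k2 r Hr _|k2 _]; first exact: kernel_term_ge0.
  exact: measurable_kernel_term.
have p1 j k1 r : halfline r -> (0 <= \sum_(k2 <oo) (kernel_term delta j k1 k2 r)%:E)%E.
  by move=> Hr; apply: nneseries_ge0 => k2 _ _; exact: kernel_term_ge0.
rewrite integral_nneseries//; last 2 first.
- by move=> j; apply: ge0_emeasurable_sum => [k1 r Hr _|k1 _]; [exact: p1|exact: m1].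
- by move=> j r Hr; apply: nneseries_ge0 => k1 _ _; exact: p1.
apply: eq_eseriesr => j _; rewrite integral_nneseries//; last by move=> k1 r; exact: p1.
rewrite -nneseriesZl; last first.
  by move=> k1 _; apply: nneseries_ge0 => k2 _ _; rewrite lee_fin inner_term_ge0.
apply: eq_eseriesr => k1 _; rewrite integral_nneseries//; last first.
  by move=> k2 r Hr; exact: kernel_term_ge0.
rewrite -nneseriesZl; last by move=> k2 _; rewrite lee_fin inner_term_ge0.
apply: eq_eseriesr => k2 _; rewrite -EFinM.
have iw := integrable_radial_weight t (2 * ell k1 k2 j + 1) b0.
under eq_integral do rewrite EFinM.
rewrite integralZl//; rewrite -[X in (_ * X)%E]fineK; last exact: integrable_fin_num.
rewrite -EFinM; congr EFin; rewrite /inner_term calI_integral//.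
by rewrite /modulus /coef /Rintegral; ring.
Qed.

(** A term of a nonnegative series with finite sum: for [delta = 0] the factor of
    [inner_esum j] in [integral_polar_kernelD] is positive. *)
Lemma inner_esum_lty j : 0 < e -> 0 < p -> (inner_esum j < +oo)%E.
Proof.
move=> ep pp; rewrite ltey; apply/negP => /eqP joo.
have := integral_polar_kernelD 0.
rewrite (@nneseries_pinfty _ _ xpredT j)//.
- move=> i _; apply: mule_ge0; last exact: inner_esum_ge0.
  by rewrite lee_fin; apply: mulr_ge0;
    rewrite ?modulus_ge0 ?exprn_ge0 ?divr_ge0 ?mulr_ge0 ?exprn_ge0.
- rewrite joo gt0_muley// lte_fin mulr0 cos0 !mulr_gt0 ?pi_gt0//.
  + by rewrite /eps_coef; case: ifP.
  + by rewrite exprn_gt0// divr_gt0// mulr_gt0// exprn_gt0.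
Qed.

End radial_series.

Section radial_expansion.
Context {R : realType}.
Notation mu := (@lebesgue_measure R).
Notation halfline := (`[0%R, +oo[%classic : set (measurableTypeR R)).
Variables (b t e p c : R).
Hypotheses (e0 : 0 <= e) (eb : e < b) (p0 : 0 <= p).

(** When [e * p = 0] and [j > 0], the inner sum is multiplied by [0] in
    [integral_polar_kernelD], which then says nothing about it. It is compared
    with the inner sum for larger parameters, still with [e < b]. *)
Lemma inner_esum_fin j : (inner_esum b t e p j < +oo)%E.
Proof.
pose e' := (e + b) / 2; pose p' := p + 1.
have ee' : e <= e' by move: e0 eb; rewrite /e'; lra.
have e'b : e' < b by move: e0 eb; rewrite /e'; lra.
have e'0 : 0 < e' by move: e0 eb; rewrite /e'; lra.
have p'0 : 0 < p' by rewrite /p' ltr_wpDl.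
have pp' : p <= p' by rewrite /p' lerDl.
apply: le_lt_trans (inner_esum_lty t 0 (ltW e'0) e'b (ltW p'0) j e'0 p'0).
apply: lee_nneseries => [k1 _ _|k1 _].
  by apply: nneseries_ge0 => k2 _ _; rewrite lee_fin inner_term_ge0.
apply: lee_nneseries => [k2 _ _|k2 _]; first by rewrite lee_fin inner_term_ge0.
rewrite lee_fin /inner_term ler_wpM2r//.
  by apply: calI_ge0; exact: le_lt_trans eb.
rewrite /coef_term ler_wpM2r//.
by rewrite ler_pM ?exprn_ge0// lerXn2r ?nnegrE// ltW.
Qed.

Let inner_rsum j := nnseries_rsum2 (inner_term_ge0 t e0 eb p0 j) (inner_esum_fin j).

(** The integral for [delta] is the sum of those for [delta] and [0], minus half of
    the sum of that for [0] with itself. *)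
Lemma radial_expansion delta :
  [/\ (forall j k1, cvgn (series (inner_term b t e p j k1))),
      (forall j, cvgn (series (fun k1 => rsum (inner_term b t e p j k1)))) &
      series (fun j => eps_coef R j * cos (2 * j%:R * delta) *
        (e * p ^+ 2 / 8) ^+ j * rsum (fun k1 => rsum (inner_term b t e p j k1)))
      @ \oo --> (2 * pi)^-1 * \int[mu]_(r in halfline) polar_kernel b t e p c delta r].
Proof.
split.
- by move=> j k1; have [] := inner_rsum j.
- by move=> j; have [] := inner_rsum j.
pose s j := rsum (fun k1 => rsum (inner_term b t e p j k1)).
have sE j : inner_esum b t e p j = (s j)%:E by have [] := inner_rsum j.
have s0 j : 0 <= s j.
  by rewrite -lee_fin -sE; apply: inner_esum_ge0.
pose u d j := 2 * pi * eps_coef R j * (1 + cos (2 * j%:R * d)) *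
    (e * p ^+ 2 / 8) ^+ j * s j.
pose m d := \int[mu]_(r in halfline) polar_kernel b t e p c d r.
have u0 d j : 0 <= u d j.
  rewrite /u; apply: mulr_ge0 => //; apply: mulr_ge0; last first.
    by rewrite exprn_ge0// divr_ge0// mulr_ge0// exprn_ge0.
  apply: mulr_ge0; last by rewrite -lerBlDl sub0r cos_geN1.
  by rewrite !mulr_ge0 ?pi_ge0// /eps_coef; case: ifP.
have cu d : series (u d) @ \oo --> m d + m 0.
  apply/nnseries_cvgP; first exact: u0.
  rewrite integral_polar_kernelD//; apply: eq_eseriesr => j _.
  by rewrite sE -EFinM.
rewrite (_ : (fun j => _) =
    (2 * pi)^-1 *: ((u delta : nat -> R^o) + (- 2^-1) *: (u 0 : nat -> R^o))).
  have key (x y : R) : x = (x + y) + - 2^-1 * (y + y) by field.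
  rewrite (key (\int[mu]_(r in halfline) polar_kernel b t e p c delta r) (m 0)).
  rewrite seriesZ; apply: cvgM; first exact: cvg_cst.
  rewrite seriesD; apply: cvgD; first exact: cu.
  by rewrite seriesZ; apply: cvgM; [exact: cvg_cst|exact: cu].
apply/funext => j; rewrite !fctE /GRing.scale/= /u -/(s j) mulr0 cos0.
have : (pi : R) != 0 by rewrite gt_eqF ?pi_gt0.
by move: pi => w w0; field.
Qed.

End radial_expansion.

(** * Integrals against a density *)

Section integral_density.
Context d (T : measurableType d) {R : realType}.
Notation lambda := (@lebesgue_measure R).
Variables (mu : {measure set T -> \bar R}) (smu : sigma_finite setT mu)
  (nu : {sigma_finite_measure set T -> \bar R}) (f : T -> R).
Hypotheses (mf : measurable_fun setT f) (f0 : forall x, 0 <= f x)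
  (nuE : forall A, measurable A -> nu A = (\int[mu]_(x in A) (f x)%:E)%E).

(* A named copy of [mu] carries the structure that [smu] provides. *)
Let mu' := Measure.sort mu.
HB.instance Definition _ := Measure.on mu'.
HB.instance Definition _ := Measure_isSigmaFinite.Build _ _ _ mu' smu.

(** Layer cake: [g x] is the length of the interval of the [s] with
    [0 <= s < g x], and Tonelli applies to both measures. *)
Lemma ge0_integral_density (g : T -> R) :
    measurable_fun setT g -> (forall x, 0 <= g x) ->
  (\int[nu]_x (g x)%:E = \int[mu]_x (g x * f x)%:E)%E.
Proof.
move=> mg g0; change (\int[nu]_x (g x)%:E = \int[mu']_x (g x * f x)%:E)%E.
have nu'E B : measurable B -> nu B = (\int[mu']_(x in B) (f x)%:E)%E by exact: nuE.
pose A : set (T * measurableTypeR R) := [set z | 0 <= z.2 < g z.1].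
have mA : measurable A.
  rewrite (_ : A = [set z | 0 <= z.2] `&` [set z | z.2 < g z.1]); last first.
    by apply/seteqP; split => z; rewrite /A/= => /andP.
  apply: measurableI.
    have := @measurable_fun_ler _ (T * measurableTypeR R)%type R setT (cst 0) snd.
    move=> /(_ (measurable_cst _) measurable_snd measurableT [set true]).
    by rewrite setTI; apply.
  have := @measurable_fun_ltr _ (T * measurableTypeR R)%type R setT snd (g \o fst).
  move=> /(_ measurable_snd (measurableT_comp mg measurable_fst) measurableT [set true]).
  by rewrite setTI; apply.
pose k z : \bar R := (\1_A z)%:E.
have mk : measurable_fun setT k by apply/measurable_EFinP; exact: measurable_indic.
have k0 z : (0 <= k z)%E by rewrite lee_fin.
have layer x : ((g x)%:E = \int[lambda]_s k (x, s))%E.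
  have <- : lambda (`[0%R, g x[%classic : set (measurableTypeR R)) = (g x)%:E.
    rewrite lebesgue_measure_itv/= lte_fin.
    case: ltP => [_|gx0]; first by rewrite sube0.
    by congr EFin; apply/eqP; rewrite eq_le gx0 g0.
  rewrite -[X in lambda X]setIT -integral_indic//.
under eq_integral do rewrite layer.
rewrite (fubini_tonelli k)//.
transitivity (\int[lambda]_s \int[mu']_x ((f x)%:E * k (x, s)))%E.
  apply: eq_integral => s _; have mAs := measurable_ysection s mA.
  have kE x : k (x, s) = (\1_(ysection A s) x)%:E.
    by rewrite /k !indicE mem_ysection.
  under eq_integral do rewrite kE.
  rewrite integral_indic// setIT; apply: (etrans (nu'E _ mAs)).
  rewrite integral_mkcond epatch_indic.
  by apply: eq_integral => x _; rewrite /= kE.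
rewrite -(fubini_tonelli (fun z => (f z.1)%:E * k z))%E; last 2 first.
- apply: emeasurable_funM => //; apply/measurable_EFinP.
  exact: (measurableT_comp mf measurable_fst).
- by move=> z; rewrite mule_ge0// lee_fin.
apply: eq_integral => x _ /=.
rewrite ge0_integralZl//=; last 2 first.
- exact: measurable_fun_pair2.
- by rewrite lee_fin.
by rewrite -layer -EFinM mulrC.
Qed.

End integral_density.

(** * The bivariate normal density in polar coordinates *)

Section bivariate_normal.
Context {R : realType}.
Variables (mu1 mu2 sigma1 sigma2 rho : R).
Hypotheses (sigma1_gt0 : 0 < sigma1) (sigma2_gt0 : 0 < sigma2)
  (rho_lt1 : `|rho| < 1).

Let K : R := sigma1 ^+ 2 * sigma2 ^+ 2 * (1 - rho ^+ 2).

Let rho2 : 0 < 1 - rho ^+ 2.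
Proof. by rewrite subr_gt0 -real_normK ?num_real// expr_lt1. Qed.

Let K_gt0 : 0 < K. Proof. by rewrite !mulr_gt0 ?exprn_gt0. Qed.

Let K4_gt0 : 0 < 4 * sigma1 ^+ 2 * sigma2 ^+ 2 * (1 - rho ^+ 2).
Proof. by rewrite !mulr_gt0 ?exprn_gt0. Qed.

Lemma det_cov2 : \det (cov2 sigma1 sigma2 rho) = K.
Proof.
rewrite (expand_det_row _ 0) big_ord_recl big_ord1 /cofactor !det_mx11 !mxE/= /K.
ring.
Qed.

Definition cov2_form (x y : R) : R :=
  (sigma2 ^+ 2 * x ^+ 2 - 2 * rho * sigma1 * sigma2 * x * y
   + sigma1 ^+ 2 * y ^+ 2) / K.

Lemma cov2_quadratic_form (v : 'cV[R]_2) :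
  (v^T *m invmx (cov2 sigma1 sigma2 rho) *m v) 0 0 = cov2_form (v 0 0) (v 1 0).
Proof.
pose B : 'M[R]_2 := \matrix_(i, j) (K^-1 *
  (if i == j then (if i == 0 then sigma2 ^+ 2 else sigma1 ^+ 2)
   else - (rho * sigma1 * sigma2))).
have K0 : K != 0 by rewrite gt_eqF.
have SB : cov2 sigma1 sigma2 rho *m B = 1%:M.
  apply/matrixP => -[[|[|//]] i2] [[|[|//]] j2];
    rewrite !mxE big_ord_recl big_ord1 !mxE/= /K; field;
    by rewrite !gt_eqF.
have -> : invmx (cov2 sigma1 sigma2 rho) = B.
  have [uS _] := mulmx1_unit SB.
  by rewrite -[RHS](mulKmx uS) SB mulmx1.
rewrite !mxE big_ord_recl big_ord1 !mxE !big_ord_recl !big_ord0 !mxE/=.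
have -> : lift ord0 ord0 = 1 :> 'I_2 by exact: val_inj.
have -> : ord0 = 0 :> 'I_2 by [].
by rewrite /cov2_form; field.
Qed.

Lemma normal2_pdfE (x y : R) :
  normal2_pdf (col2 mu1 mu2) (cov2 sigma1 sigma2 rho) (x, y) =
  (2 * pi * (sigma1 * sigma2 * Num.sqrt (1 - rho ^+ 2)))^-1
  * expR (- (cov2_form (x - mu1) (y - mu2) / 2)).
Proof.
rewrite /normal2_pdf det_cov2 cov2_quadratic_form !mxE/=.
congr ((_ * _)^-1 * _).
rewrite /K -exprMn sqrtrM ?sqr_ge0// sqrtr_sqr ger0_norm//.
by rewrite ltW// mulr_gt0.
Qed.

Let b := cst_beta sigma1 sigma2 rho.
Let e := cst_eta sigma1 sigma2 rho.
Let p := cst_psi mu1 mu2 sigma1 sigma2 rho.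
Let alpha := cst_alpha mu1 mu2 sigma1 sigma2 rho.

Lemma cst_eta_ge0 : 0 <= e.
Proof. by rewrite divr_ge0 ?sqrtr_ge0// ltW. Qed.

Lemma cst_psi_ge0 : 0 <= p.
Proof. by rewrite divr_ge0 ?sqrtr_ge0// ltW. Qed.

(** Equivalently, the matrix [cov2] is positive definite. *)
Lemma cst_eta_lt_beta : e < b.
Proof.
rewrite /e /b /cst_eta /cst_beta.
rewrite ltr_pM2r ?invr_gt0//.
have s0 : 0 <= sigma1 ^+ 2 + sigma2 ^+ 2 by rewrite addr_ge0 ?sqr_ge0.
rewrite -(@ltr_pXn2r _ 2)// ?nnegrE ?sqrtr_ge0// sqr_sqrtr; last first.
  rewrite addr_ge0 ?sqr_ge0//.
  have -> : 4 * sigma1 ^+ 2 * sigma2 ^+ 2 * rho ^+ 2 =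
    (2 * sigma1 * sigma2 * rho) ^+ 2 by ring.
  exact: sqr_ge0.
by rewrite -subr_gt0; move: K4_gt0; congr (0 < _); ring.
Qed.

Section angles.
Variables phit phi : R.
Hypotheses (phitP : is_phit mu1 mu2 sigma1 sigma2 rho phit)
  (phiP : is_phi sigma1 sigma2 rho phi).

(** When the denominator in the definition of the angle vanishes, both sides are
    [0] for every angle; likewise below. *)
Lemma cst_eta_polar :
  e * cos phi = (sigma2 ^+ 2 - sigma1 ^+ 2) / (4 * K) /\
  e * sin phi = 2 * rho * sigma1 * sigma2 / (4 * K).
Proof.
have K0 : K != 0 by rewrite gt_eqF.
have eE : e = phi_denom sigma1 sigma2 rho / (4 * K).
  rewrite /e /cst_eta /phi_denom /K; congr (Num.sqrt _ / _); ring.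
rewrite eE; move: phiP; rewrite /is_phi/=.
have [E0 _|E0 /(_ isT) [-> ->]] := eqVneq (phi_denom sigma1 sigma2 rho) 0.
  move: (E0) => /eqP; rewrite sqrtr_eq0 => h.
  have s0 : (sigma1 ^+ 2 - sigma2 ^+ 2) ^+ 2 + (2 * rho * sigma1 * sigma2) ^+ 2 = 0.
    apply/eqP; rewrite eq_le addr_ge0 ?sqr_ge0// andbT.
    by apply: le_trans h; rewrite le_eqVlt; apply/orP; left; apply/eqP; ring.
  have /eqP := s0; rewrite paddr_eq0 ?sqr_ge0// => /andP[/eqP s1 /eqP s2].
  rewrite E0 !mul0r.
  have -> : sigma2 ^+ 2 - sigma1 ^+ 2 = 0.
    by apply/eqP; rewrite -oppr_eq0 opprB -sqrf_eq0 s1.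
  have -> : 2 * rho * sigma1 * sigma2 = 0 by apply/eqP; rewrite -sqrf_eq0 s2.
  by rewrite !mul0r.
by split; field; rewrite K0 E0.
Qed.

Lemma cst_psi_polar :
  p * cos phit = (mu2 * sigma1 ^+ 2 - rho * mu1 * sigma1 * sigma2) / K /\
  p * sin phit = (mu1 * sigma2 ^+ 2 - rho * mu2 * sigma1 * sigma2) / K.
Proof.
have K0 : K != 0 by rewrite gt_eqF.
have pE : p = phit_denom mu1 mu2 sigma1 sigma2 rho / K.
  rewrite /p /cst_psi /phit_denom; congr (Num.sqrt _ / _); ring.
rewrite pE; move: phitP; rewrite /is_phit/=.
have [D0 _|D0 /(_ isT) [-> ->]] :=
    eqVneq (phit_denom mu1 mu2 sigma1 sigma2 rho) 0.
  move: (D0) => /eqP; rewrite sqrtr_eq0 => h.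
  have s0 : (mu2 * sigma1 ^+ 2 - rho * mu1 * sigma1 * sigma2) ^+ 2 +
      (mu1 * sigma2 ^+ 2 - rho * mu2 * sigma1 * sigma2) ^+ 2 = 0.
    apply/eqP; rewrite eq_le addr_ge0 ?sqr_ge0// andbT.
    by apply: le_trans h; rewrite le_eqVlt; apply/orP; left; apply/eqP; ring.
  have /eqP := s0; rewrite paddr_eq0 ?sqr_ge0// !sqrf_eq0 => /andP[/eqP s1 /eqP s2].
  by rewrite D0 s1 s2 !mul0r.
by split; field; rewrite K0 D0.
Qed.

(** The exponent depends on the angle through
    [- e r^2 cos (2 omega + phi) + p r sin (omega + phit)]. The shift by
    [phit - pi / 2] turns the sine into a cosine, and [2 omega + phi] into
    [2 u - 2 delta + pi], whose cosine absorbs the sign. *)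
Lemma normal2_pdf_polar (r omega : R) :
  normal2_pdf (col2 mu1 mu2) (cov2 sigma1 sigma2 rho) (r * cos omega, r * sin omega) =
  alpha / (2 * pi) * expR (- (b * r ^+ 2))
  * expR (phase (e * r ^+ 2) (p * r) (phit - phi / 2) (omega + (phit - pi / 2))).
Proof.
rewrite normal2_pdfE /alpha /cst_alpha.
have K0 : K != 0 by rewrite gt_eqF.
have -> : - (cov2_form (r * cos omega - mu1) (r * sin omega - mu2) / 2) =
    - ((mu1 ^+ 2 * sigma2 ^+ 2 + sigma1 ^+ 2 * mu2 ^+ 2
        - 2 * rho * sigma1 * sigma2 * mu1 * mu2) / (2 * K))
    + (- (b * r ^+ 2)
       + phase (e * r ^+ 2) (p * r) (phit - phi / 2) (omega + (phit - pi / 2))).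
  have -> : phase (e * r ^+ 2) (p * r) (phit - phi / 2) (omega + (phit - pi / 2)) =
      - (r ^+ 2 * (e * cos (2 * omega + phi))) + r * (p * sin (omega + phit)).
    rewrite /phase (addrA omega) cosBpihalf.
    have -> : 2 * (omega + phit - pi / 2) - 2 * (phit - phi / 2) =
      (2 * omega + phi) - pi by field.
    rewrite -[cos (_ - pi)]opprK -cosDpi subrK; ring.
  have [ec es] := cst_eta_polar; have [pc ps] := cst_psi_polar.
  have -> : e * cos (2 * omega + phi) =
      (cos omega ^+ 2 - sin omega ^+ 2) * ((sigma2 ^+ 2 - sigma1 ^+ 2) / (4 * K))
      - 2 * sin omega * cos omega * (2 * rho * sigma1 * sigma2 / (4 * K)).
    by rewrite -ec -es mulr_natl mulr2n cosD (cosD omega) (sinD omega); ring.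
  have -> : p * sin (omega + phit) =
      sin omega * ((mu2 * sigma1 ^+ 2 - rho * mu1 * sigma1 * sigma2) / K)
      + cos omega * ((mu1 * sigma2 ^+ 2 - rho * mu2 * sigma1 * sigma2) / K).
    by rewrite -pc -ps sinD; ring.
  have -> : b * r ^+ 2 = (sigma1 ^+ 2 + sigma2 ^+ 2) / (4 * K) * r ^+ 2
      * (cos omega ^+ 2 + sin omega ^+ 2).
    by rewrite cos2Dsin2 mulr1 /b /cst_beta /K !mulrA.
  by rewrite /cov2_form; field.
rewrite !expRD; set N := expR (- (_ / (2 * K))).
have -> : expR (- ((mu1 ^+ 2 * sigma2 ^+ 2 + sigma1 ^+ 2 * mu2 ^+ 2
        - 2 * rho * sigma1 * sigma2 * mu1 * mu2)
         / (2 * sigma1 ^+ 2 * sigma2 ^+ 2 * (1 - rho ^+ 2)))) = N.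
  by rewrite /N /K !mulrA.
by rewrite invfM; ring.
Qed.

End angles.

End bivariate_normal.

(** * The moment generating function of the radius *)

Lemma sigma_finite_plane (R : realType) :
  sigma_finite setT ((@lebesgue_measure R) \x (@lebesgue_measure R))%E.
Proof.
pose box (n : nat) : set (measurableTypeR R) := `[- n%:R, n%:R]%classic.
have mbox n : measurable (box n) by exact: measurable_itv.
exists (fun n => box n `*` box n).
  apply/seteqP; split => // -[x y] _.
  exists (Num.trunc (Num.max `|x| `|y|)).+1 => //.
  have := truncnS_gt (Num.max `|x| `|y|).
  by rewrite gt_max /box/= !in_itv/= -!ler_norml => /andP[/ltW -> /ltW ->].
move=> n; split; first exact: measurableX.
have boxE : lebesgue_measure (box n) = (if 0 < n%:R :> R then n%:R + n%:R else 0)%:E.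
  transitivity (lebesgue_measure `[- n%:R, n%:R : R]%classic) => //.
  rewrite lebesgue_measure_itv/= lte_fin -subr_gt0 opprK -mulr2n pmulrn_lgt0//.
  by case: ifP => _; rewrite // -EFinB opprK mulr2n.
rewrite product_measure1E//.
apply: (@le_lt_trans _ _ (((if 0 < n%:R :> R then n%:R + n%:R else 0)%:E)
  * ((if 0 < n%:R :> R then n%:R + n%:R else 0)%:E))%E).
  by rewrite -boxE.
by rewrite -EFinM ltry.
Qed.

Section radius_mgf.
Context d (Omega : measurableType d) {R : realType} (P : probability Omega R)
  (X : {RV P >-> (R * R)%type}).
Notation mu := (@lebesgue_measure R).
Notation halfline := (`[0%R, +oo[%classic : set (measurableTypeR R)).
Variables (mu1 mu2 sigma1 sigma2 rho phit phi t : R).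
Hypotheses (sigma1_gt0 : 0 < sigma1) (sigma2_gt0 : 0 < sigma2)
  (rho_lt1 : `|rho| < 1)
  (X_normal : normal2 X (col2 mu1 mu2) (cov2 sigma1 sigma2 rho))
  (phitP : is_phit mu1 mu2 sigma1 sigma2 rho phit)
  (phiP : is_phi sigma1 sigma2 rho phi).

Let a := cst_alpha mu1 mu2 sigma1 sigma2 rho.
Let b := cst_beta sigma1 sigma2 rho.
Let e := cst_eta sigma1 sigma2 rho.
Let p := cst_psi mu1 mu2 sigma1 sigma2 rho.
Let pdf := normal2_pdf (col2 mu1 mu2) (cov2 sigma1 sigma2 rho).
Let weight (z : R * R) : R := expR (Num.sqrt (z.1 ^+ 2 + z.2 ^+ 2) * t).

Let pdfE z : pdf z =
  (2 * pi * (sigma1 * sigma2 * Num.sqrt (1 - rho ^+ 2)))^-1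
  * expR (- (cov2_form sigma1 sigma2 rho (z.1 - mu1) (z.2 - mu2) / 2)).
Proof. by case: z => x y; rewrite /pdf normal2_pdfE. Qed.

Let pdf_ge0 z : 0 <= pdf z.
Proof.
rewrite pdfE mulr_ge0 ?expR_ge0// invr_ge0 !mulr_ge0 ?pi_ge0 ?sqrtr_ge0//; exact: ltW.
Qed.

Let weight_ge0 z : 0 <= weight z. Proof. exact: expR_ge0. Qed.

Let measurable_weight : measurable_fun setT weight.
Proof.
apply: measurableT_comp => //; apply: measurable_funM => //.
apply: measurableT_comp.
  exact: continuous_measurable_fun (@sqrt_continuous R).
by apply: measurable_funD; exact: measurable_funX.
Qed.

Let measurable_pdf : measurable_fun setT pdf.
Proof.
apply: (eq_measurable_fun (fun z : R * R =>
  (2 * pi * (sigma1 * sigma2 * Num.sqrt (1 - rho ^+ 2)))^-1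
  * expR (- (cov2_form sigma1 sigma2 rho (z.1 - mu1) (z.2 - mu2) / 2)))).
  by move=> z _; rewrite pdfE.
have m1 : measurable_fun setT (fun z : R * R => z.1 - mu1).
  exact: measurable_funB.
have m2 : measurable_fun setT (fun z : R * R => z.2 - mu2).
  exact: measurable_funB.
apply: measurable_funM => //; apply: measurableT_comp => //.
apply: measurableT_comp => //; apply: measurable_funM => //.
apply: measurable_funM => //; apply: measurable_funD.
  apply: measurable_funB.
    by apply: measurable_funM => //; exact: measurable_funX.
  by apply: measurable_funM => //; exact: measurable_funM.
by apply: measurable_funM => //; exact: measurable_funX.
Qed.

Let cfst : continuous (fun z : R * R => z.1).
Proof. by move=> z; exact: cvg_fst. Qed.

Let csnd : continuous (fun z : R * R => z.2).
Proof. by move=> z; exact: cvg_snd. Qed.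

Let csqr (h : R * R -> R) : continuous h -> continuous (fun z => h z ^+ 2).
Proof.
move=> ch z; apply: (@continuous_comp _ _ _ h (fun x : R => x ^+ 2)).
  exact: ch.
exact: exprn_continuous.
Qed.

Let cmul (h k : R * R -> R) : continuous h -> continuous k ->
  continuous (fun z => h z * k z).
Proof. by move=> ch ck z; apply: cvgM; [exact: ch|exact: ck]. Qed.

Let cadd (h k : R * R -> R) : continuous h -> continuous k ->
  continuous (fun z => h z + k z).
Proof. by move=> ch ck z; apply: cvgD; [exact: ch|exact: ck]. Qed.

Let copp (h : R * R -> R) : continuous h -> continuous (fun z => - h z).
Proof. by move=> ch z; apply: cvgN; exact: ch. Qed.

Let ccst (k : R) : continuous (fun _ : R * R => k).
Proof. by move=> z; exact: cvg_cst. Qed.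

Let cexp (h : R * R -> R) : continuous h -> continuous (fun z => expR (h z)).
Proof.
move=> ch z; apply: (@continuous_comp _ _ _ h expR); first exact: ch.
exact: continuous_expR.
Qed.

Let continuous_weight : continuous weight.
Proof.
apply: cexp; apply: cmul; last exact: ccst.
have cs : continuous (fun z : R * R => z.1 ^+ 2 + z.2 ^+ 2).
  by apply: cadd; exact: csqr.
move=> z; apply: (@continuous_comp _ _ _ (fun z : R * R => z.1 ^+ 2 + z.2 ^+ 2)
  Num.sqrt); first exact: cs.
exact: sqrt_continuous.
Qed.

Let continuous_pdf : continuous pdf.
Proof.
rewrite (_ : pdf = fun z : R * R =>
  (2 * pi * (sigma1 * sigma2 * Num.sqrt (1 - rho ^+ 2)))^-1
  * expR (- (cov2_form sigma1 sigma2 rho (z.1 - mu1) (z.2 - mu2) / 2))); last first.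
  by apply/funext => z; exact: pdfE.
have c1 : continuous (fun z : R * R => z.1 - mu1) by apply: cadd.
have c2 : continuous (fun z : R * R => z.2 - mu2) by apply: cadd.
apply: cmul; first exact: ccst.
apply: cexp; apply: copp; apply: cmul; last exact: ccst.
apply: cmul; last exact: ccst.
apply: cadd; last by apply: cmul; [exact: ccst|exact: csqr].
apply: cadd; first by apply: cmul; [exact: ccst|exact: csqr].
by apply: copp; apply: cmul => //; apply: cmul => //; exact: ccst.
Qed.

Let fold_weight r theta : 0 <= r ->
  r * fold_polar (fun z => weight z * pdf z) r theta =
  a / (2 * pi) * (radial_weight b t 1 r *
   (expR (phase (e * r ^+ 2) (p * r) (phit - phi / 2) (theta + (phit - pi / 2))) +
    expR (phase (e * r ^+ 2) (p * r) (phit - phi / 2) (pi - theta + (phit - pi / 2))))).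
Proof.
move=> r0; have W omega : weight (r * cos omega, r * sin omega) = expR (t * r).
  rewrite /weight/= !exprMn -mulrDr cos2Dsin2 mulr1 sqrtr_sqr ger0_norm//.
  by rewrite mulrC.
have -> : fold_polar (fun z => weight z * pdf z) r theta =
    expR (t * r) * pdf (r * cos theta, r * sin theta) +
    expR (t * r) * pdf (r * cos (pi - theta), r * sin (pi - theta)).
  rewrite -{1}(W theta) -(W (pi - theta)) /fold_polar.
  have -> : cos (pi - theta) = - cos theta.
    by rewrite cosB cospi sinpi mul0r addr0 mulN1r.
  have -> : sin (pi - theta) = sin theta.
    by rewrite sinB cospi sinpi mul0r sub0r mulN1r opprK.
  by rewrite mulrN.
rewrite /pdf !(normal2_pdf_polar sigma1_gt0 sigma2_gt0 rho_lt1 phitP phiP).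
rewrite /radial_weight (expRD (t * r)) -/a -/b -/e -/p; ring.
Qed.

(* The same random vector for the measurable structure of the product measure. *)
Let X' : Omega -> (measurableTypeR R * measurableTypeR R)%type := X.
Let measurable_X' : measurable_fun setT X'. Proof. exact: measurable_funP X. Qed.
HB.instance Definition _ := isMeasurableFun.Build _ _ _ _ X' measurable_X'.

Lemma mgf_radius :
  'M_P (fun w => Num.sqrt ((X w).1 ^+ 2 + (X w).2 ^+ 2)) t =
  (a * ((2 * pi)^-1 * \int[mu]_(r in halfline)
     polar_kernel b t e p (phit - pi / 2) (phit - phi / 2) r))%:E.
Proof.
rewrite /mmt_gen_fun unlock.
transitivity (\int[distribution P X']_z (weight z)%:E)%E.
  rewrite ge0_integral_distribution//; exact/measurable_EFinP.
rewrite (@ge0_integral_density _ (measurableTypeR R * measurableTypeR R)%type R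
  (mu \x mu)%E (sigma_finite_plane R) (distribution P X') pdf)//.
rewrite (@polar_coordinates _ (fun z => weight z * pdf z)); last 3 first.
- exact: cmul.
- exact: measurable_funM.
- by move=> z; rewrite mulr_ge0.
transitivity (\int[mu]_(r in halfline) ((a / (2 * pi))%:E *
  (polar_kernel b t e p (phit - pi / 2) (phit - phi / 2) r)%:E))%E.
  apply: eq_integral => r; rewrite inE/= in_itv/= andbT => r0.
  under eq_integral do rewrite fold_weight// mulrA EFinM.
  rewrite integralZl//; last exact: integrable_angular.
  rewrite -[X in (_ * X)%E]fineK; last first.
    by apply: integrable_fin_num => //; exact: integrable_angular.
  by rewrite -!EFinM; congr EFin; exact: (esym (mulrA _ _ _)).
have ip : mu.-integrable halfline (EFin \o
    polar_kernel b t e p (phit - pi / 2) (phit - phi / 2)).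
  apply: integrable_polar_kernel.
  - exact: cst_eta_ge0.
  - exact: cst_eta_lt_beta.
  - exact: cst_psi_ge0.
rewrite integralZl// -[X in (_ * X)%E]fineK; last exact: integrable_fin_num.
by rewrite -EFinM /Rintegral mulrA.
Qed.

End radius_mgf.

(** * The expansion *)

Theorem claim2 (R : realType) (d : measure_display) (Omega : measurableType d)
    (P : probability Omega R) (X : {RV P >-> (R * R)%type})
    (mu1 mu2 sigma1 sigma2 rho phit phi : R)
    (sigma1_gt0 : 0 < sigma1) (sigma2_gt0 : 0 < sigma2) (rho_lt1 : `|rho| < 1)
    (X_normal : normal2 X (col2 mu1 mu2) (cov2 sigma1 sigma2 rho))
    (phitP : is_phit mu1 mu2 sigma1 sigma2 rho phit)
    (phiP : is_phi sigma1 sigma2 rho phi) :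
  let a := cst_alpha mu1 mu2 sigma1 sigma2 rho in
  let b := cst_beta sigma1 sigma2 rho in
  let e := cst_eta sigma1 sigma2 rho in
  let p := cst_psi mu1 mu2 sigma1 sigma2 rho in
  let delta := phit - phi / 2 in
  let radius := fun w : Omega => Num.sqrt ((X w).1 ^+ 2 + (X w).2 ^+ 2) in
  let term := fun (t : R) (j k1 k2 : nat) =>
    coef_term k1 k2 j p e * calI b (2 * ell k1 k2 j + 1) t in
  let outer := fun (t : R) (j : nat) =>
    eps_coef R j * cos (2 * j%:R * delta) * (e * p ^+ 2 / 8) ^+ j
    * rsum (fun k1 => rsum (fun k2 => term t j k1 k2)) in
  (forall t : R,
    [/\ 'M_P radius t \is a fin_num,
        (forall j k1, cvgn (series (fun k2 => term t j k1 k2))),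
        (forall j, cvgn (series (fun k1 => rsum (fun k2 => term t j k1 k2)))),
        cvgn (series (outer t)) &
        'M_P radius t = (a * rsum (outer t))%:E]) /\
  (forall (m : nat) (t : R), odd m ->
    calI b m t =
      Num.sqrt pi * expR (t ^+ 2 / (4 * b)) / (2 * b `^ ((m%:R + 1) / 2))
      * (Gamma (m%:R / 2 + 1)
           * Laguerre (- (1 / 2)) (m%:R / 2) (- (t ^+ 2 / (4 * b)))
         + t / (2 * Num.sqrt b) * Gamma ((m%:R + 1) / 2)
           * Laguerre (1 / 2) ((m%:R - 1) / 2) (- (t ^+ 2 / (4 * b))))).
Proof.
move=> a b e p delta radius term outer.
have e0 : 0 <= e by exact: cst_eta_ge0.
have eb : e < b by exact: cst_eta_lt_beta.
have p0 : 0 <= p by exact: cst_psi_ge0.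
split; last by move=> m t _; apply: calI_Laguerre; exact: le_lt_trans eb.
move=> t.
have [inner_cvg middle_cvg outer_cvg] :=
  radial_expansion t (phit - pi / 2) e0 eb p0 delta.
have mgfE := mgf_radius t sigma1_gt0 sigma2_gt0 rho_lt1 X_normal phitP phiP.
split.
- by rewrite mgfE.
- exact: inner_cvg.
- exact: middle_cvg.
- by apply: cvgP; exact: outer_cvg.
- rewrite mgfE; congr (a * _)%:E; apply/esym.
  by apply: cvg_lim => //; exact: outer_cvg.
Qed.
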